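(* For $n\ge3$, the automorphism group $\operatorname{Aut}(KD(n))$ of the Kac algebra $KD(n)$ is $$A_{2n}=\{\Theta_k,\ \Theta_k\Theta'\ \mid\ k \text{ coprime to } 2n\}.$$ In particular, it is of order $2\varphi(2n)$ (where $\varphi$ is the Euler function), and isomorphic to $\mathbb{Z}_{2n}^*\rtimes\mathbb{Z}_2$, where $\mathbb{Z}_{2n}^*$ is the multiplicative group of units of $\mathbb{Z}_{2n}$.
   Context: A finite-dimensional Kac algebra is a finite-dimensional $C^*$-algebra $K$ with a Hopf algebra structure $(\Delta,\varepsilon,S)$ for which $\Delta$ is a $*$-homomorphism; automorphisms are $*$-algebra automorphisms compatible with the coproduct. $KD(n)$ ($n\ge1$): let $D_{2n}=\langle a,b\mid a^{2n}=b^2=1,\ ba=a^{-1}b\rangle$ (order $4n$), with canonical basis $\lambda(g)$ of $\mathbb{C}[D_{2n}]$, and $\Delta_s(\lambda(g))=\lambda(g)\otimes\lambda(g)$. Put $h_1=1,h_2=a^n,h_3=b,h_4=ba^n$, $\nu=-1+2\mathrm{i}$, and $\Omega=\sum_{i,j}c_{i,j}\lambda(h_i)\otimes\lambda(h_j)$ with $$(c_{i,j})=\frac18\begin{pmatrix}5&1&1&1\\1&1&\bar\nu&\nu\\1&\nu&1&\bar\nu\\1&\bar\nu&\nu&1\end{pmatrix}.$$ $\Omega$ is unitary. $KD(n)$ is the $*$-algebra $\mathbb{C}[D_{2n}]$ with its usual counit and antipode and the coproduct $\Delta(x)=\Omega\Delta_s(x)\Omega^*$. For $k$ coprime to $2n$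 (taken modulo $2n$), $\Theta_k$ is the algebra morphism with $\Theta_k(\lambda(a))=\lambda(a^k)$, $\Theta_k(\lambda(b))=\lambda(b)$. $\Theta'$ is the algebra morphism with $\Theta'(\lambda(a))=\lambda(a)-\frac12(\lambda(a)-\lambda(a^{-1}))(1+\lambda(a^n))$ and $\Theta'(\lambda(b))=\lambda(a^nb)$. *)

(* Defs.v *)
From HB Require Import structures.
From mathcomp Require Import all_boot all_order all_algebra all_fingroup.
From mathcomp Require Import all_solvable all_field.
From mathcomp Require Import boolp classical_sets functions cardinality reals.
From mathcomp Require Import complex.

Set Implicit Arguments.
Unset Strict Implicit.
Unset Printing Implicit Defensive.

Import Order.TTheory GRing.Theory Num.Theory.
Local Open Scope ring_scope.

(* The group algebra C[G]: functions G -> C under convolution, with C^o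
   (C as a vector space over itself) providing the vectType structure. *)
Definition galg (C : numClosedFieldType) (G : finGroupType) := {ffun G -> C^o}.

Section GroupAlgebra.
Variables (C : numClosedFieldType) (G : finGroupType).
Implicit Types (x y z : galg C G) (g h : G).

HB.instance Definition _ := Vector.on (galg C G).

Definition lambda g : galg C G := [ffun h => (h == g)%:R].

Definition galg_mul x y : galg C G := [ffun g => \sum_h x h * y (h^-1 * g)%g].

Lemma galg_mulE x y g : galg_mul x y g = \sum_h x h * y (h^-1 * g)%g.
Proof. by rewrite ffunE. Qed.

Fact galg_mulA : associative galg_mul.
Proof.
move=> x y z; apply/ffunP=> g; rewrite !galg_mulE.
under eq_bigr => h _ do rewrite galg_mulE big_distrr /=.
under [RHS]eq_bigr => h _ do rewrite galg_mulE big_distrl /=.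
rewrite [RHS]exchange_big /=; apply: eq_bigr => h _.
rewrite [RHS](reindex_inj (mulgI h)) /=; apply: eq_bigr => k _.
by rewrite mulKg invMg !mulgA mulrA.
Qed.

Fact galg_mul1r : left_id (lambda 1) galg_mul.
Proof.
move=> x; apply/ffunP=> g; rewrite galg_mulE (bigD1 1%g) //= ffunE eqxx mul1r.
rewrite invg1 mul1g big1 ?addr0 // => h /negPf hn1.
by rewrite ffunE hn1 mul0r.
Qed.

Fact galg_mulr1 : right_id (lambda 1) galg_mul.
Proof.
move=> x; apply/ffunP=> g; rewrite galg_mulE (bigD1 g) //= ffunE mulVg eqxx.
rewrite mulr1 big1 ?addr0 // => h hg; rewrite ffunE -eq_invg_mul invgK.
by rewrite (negPf hg) mulr0.
Qed.

Fact galg_mulDl : left_distributive galg_mul +%R.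
Proof.
move=> x y z; apply/ffunP=> g; rewrite [in RHS]ffunE !galg_mulE -big_split /=.
by apply: eq_bigr => h _; rewrite ffunE mulrDl.
Qed.

Fact galg_mulDr : right_distributive galg_mul +%R.
Proof.
move=> x y z; apply/ffunP=> g; rewrite [in RHS]ffunE !galg_mulE -big_split /=.
by apply: eq_bigr => h _; rewrite ffunE mulrDr.
Qed.

Fact galg_1neq0 : lambda 1 != 0.
Proof.
apply/eqP => /ffunP /(_ 1%g); rewrite !ffunE eqxx => /eqP.
by rewrite oner_eq0.
Qed.

HB.instance Definition _ := GRing.Zmodule_isNzRing.Build (galg C G)
  galg_mulA galg_mul1r galg_mulr1 galg_mulDl galg_mulDr galg_1neq0.

Fact galg_scalerAl (c : C) x y : c *: (x * y) = (c *: x) * y.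
Proof.
apply/ffunP=> g; rewrite [in LHS]ffunE !galg_mulE.
rewrite scaler_sumr; apply: eq_bigr => h _.
by rewrite [(_ *: x) h]ffunE scalerAl.
Qed.

HB.instance Definition _ :=
  GRing.Lmodule_isLalgebra.Build C (galg C G) galg_scalerAl.

Fact galg_scalerAr (c : C) x y : c *: (x * y) = x * (c *: y).
Proof.
apply/ffunP=> g; rewrite [in LHS]ffunE !galg_mulE.
rewrite scaler_sumr; apply: eq_bigr => h _.
by rewrite [(_ *: y) _]ffunE scalerAr.
Qed.

HB.instance Definition _ :=
  GRing.Lalgebra_isAlgebra.Build C (galg C G) galg_scalerAr.

HB.instance Definition _ := Algebra_isFalgebra.Build C (galg C G).

Definition star x : galg C G := [ffun g => (x (g^-1)%g : C)^*].

Lemma lambda1 : lambda 1 = 1. Proof. by []. Qed.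

Lemma lambdaM g h : lambda (g * h) = lambda g * lambda h.
Proof.
apply/ffunP=> k; rewrite galg_mulE (bigD1 g) //= !ffunE eqxx mul1r.
rewrite big1 ?addr0 => [|i /negPf ig]; last by rewrite ffunE ig mul0r.
by rewrite -(inj_eq (mulgI g) _ h) mulKVg.
Qed.

Lemma star_lambda g : star (lambda g) = lambda g^-1.
Proof. by apply/ffunP=> h; rewrite !ffunE conjC_nat eq_invg_sym eq_sym. Qed.

Lemma galg_basis x : x = \sum_g x g *: lambda g.
Proof.
apply/ffunP=> g; rewrite sum_ffunE (bigD1 g) //= !ffunE eqxx.
rewrite big1 ?addr0 => [|h hg]; first by rewrite /GRing.scale /= mulr1.
by rewrite !ffunE eq_sym (negPf hg) scaler0.
Qed.

Section LinExt.
Variables (V : vectType C) (f : G -> V).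

Definition lin_ext_fun x : V := \sum_g x g *: f g.

Fact lin_ext_is_linear : linear lin_ext_fun.
Proof.
move=> c x y; rewrite /lin_ext_fun scaler_sumr -big_split /=.
by apply: eq_bigr => g _; rewrite !ffunE scalerDl scalerA.
Qed.

HB.instance Definition _ :=
  GRing.isLinear.Build C (galg C G) V *:%R lin_ext_fun lin_ext_is_linear.

Definition lin_ext : 'Hom(galg C G, V) := linfun lin_ext_fun.

Lemma lin_extE x : lin_ext x = \sum_g x g *: f g.
Proof. by rewrite lfunE. Qed.

Lemma lin_ext_lambda g : lin_ext (lambda g) = f g.
Proof.
rewrite lin_extE (bigD1 g) //= ffunE eqxx scale1r big1 ?addr0 // => h hg.
by rewrite ffunE (negPf hg) scale0r.
Qed.

End LinExt.

Lemma lfun_lambdaP (V : vectType C) (f1 f2 : 'Hom(galg C G, V)) :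
  (forall g, f1 (lambda g) = f2 (lambda g)) -> f1 = f2.
Proof.
move=> f12; apply/lfunP=> x; rewrite [x]galg_basis !linear_sum /=.
by apply: eq_bigr => g _; rewrite !linearZ /= f12.
Qed.

End GroupAlgebra.

Section KacData.
Variables (C : numClosedFieldType) (G : finGroupType).
Implicit Types (x y z : galg C G) (g h : G) (phi psi : 'End(galg C G)).

(* C[G] (x) C[G] is identified with C[G * G] through
   lambda g (x) lambda h = lambda (g, h). *)
Definition tensor x y : galg C (G * G)%type :=
  [ffun p : G * G => x p.1 * y p.2].

Definition tensor_map phi : 'End(galg C (G * G)%type) :=
  lin_ext (fun p : G * G => tensor (phi (lambda C p.1)) (phi (lambda C p.2))).

Lemma tensor_lambda g h :
  tensor (lambda C g) (lambda C h) = lambda C ((g, h) : (G * G)%type).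
Proof. by apply/ffunP=> -[k l]; rewrite !ffunE xpair_eqE -natrM mulnb. Qed.

Lemma tensorM x y x' y' : tensor (x * x') (y * y') = tensor x y * tensor x' y'.
Proof.
apply/ffunP=> -[g h]; rewrite galg_mulE ffunE /= !galg_mulE big_distrlr /=.
rewrite pair_bigA /=; apply: eq_bigr => -[k l] _; rewrite !ffunE /=.
by rewrite mulrACA.
Qed.

Lemma tensor_mapE phi x y : tensor_map phi (tensor x y) = tensor (phi x) (phi y).
Proof.
rewrite lin_extE {2}[x]galg_basis {2}[y]galg_basis !linear_sum /=.
apply/ffunP=> -[g h]; rewrite !(sum_ffunE, ffunE) /= big_distrlr /=.
rewrite pair_bigA /=; apply: eq_bigr => -[k l] _; rewrite !linearZ !ffunE /=.
by rewrite -!/(GRing.mul _ _) mulrACA.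
Qed.

(* The *-algebra is always C[G] with (lambda g)^* = lambda g^-1; only the
   Hopf operations vary. *)
Record kac_data := KacData {
  comult : 'Hom(galg C G, galg C (G * G)%type);
  counit : 'Hom(galg C G, C^o);
  antipode : 'End(galg C G)
}.

(* Injectivity is bijectivity here, by finite dimension.  The counit and the
   antipode are determined by the algebra and the coproduct. *)
Definition kac_aut (K : kac_data) : set 'End(galg C G) :=
  [set phi | [/\ ahom_in fullv phi,
                 lker phi == 0%VS,
                 forall x, phi (star x) = star (phi x)
               & (comult K \o phi = tensor_map phi \o comult K)%VF]]%classic.

Lemma tensor_map1 : tensor_map \1 = \1%VF.
Proof.
apply: lfun_lambdaP => -[g h].
by rewrite lin_ext_lambda !id_lfunE tensor_lambda.
Qed.

Lemma tensor_map_comp phi psi :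
  tensor_map (phi \o psi) = (tensor_map phi \o tensor_map psi)%VF.
Proof.
apply: lfun_lambdaP => -[g h].
by rewrite comp_lfunE -tensor_lambda !tensor_mapE !comp_lfunE.
Qed.

Lemma kac_aut1 K : (\1%VF \in kac_aut K).
Proof.
rewrite inE; split=> [||x|]; rewrite ?id_lfunE ?id_is_ahom //.
  by apply/lker0P=> x y; rewrite !id_lfunE.
by rewrite tensor_map1 comp_lfun1r comp_lfun1l.
Qed.

Lemma kac_autM K phi psi :
  phi \in kac_aut K -> psi \in kac_aut K -> (phi \o psi)%VF \in kac_aut K.
Proof.
rewrite !inE => -[phiM phi0 phiS phiD] [psiM psi0 psiS psiD]; split.
- exact: comp_is_ahom.
- by apply/lker0P=> x y; rewrite !comp_lfunE => /(lker0P phi0)/(lker0P psi0).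
- by move=> x; rewrite !comp_lfunE psiS phiS.
- by rewrite tensor_map_comp -comp_lfunA -psiD !comp_lfunA phiD.
Qed.

Lemma kac_autV K phi : phi \in kac_aut K -> (phi^-1)%VF \in kac_aut K.
Proof.
rewrite !inE => -[/ahom_inP[phiM phi1] phi0 phiS phiD].
have phiK : cancel phi (phi^-1)%VF by move=> x; rewrite lker0_lfunK.
have phiVK : cancel (phi^-1)%VF phi by move=> x; rewrite lker0_lfunVK.
split.
- apply/ahom_inP; split=> [x y _ _|]; last by rewrite -phi1 phiK.
  by apply: (can_inj phiK); rewrite phiM ?memvf // !phiVK.
- by apply/lker0P; apply: can_inj phiVK.
- by move=> x; apply: (can_inj phiK); rewrite phiS !phiVK.
- have phiphiV : (phi \o phi^-1 = \1)%VF by rewrite lker0_compfV.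
  have phiVphi : (phi^-1 \o phi = \1)%VF by rewrite lker0_compVf.
  rewrite -[LHS]comp_lfun1l -tensor_map1 -phiVphi tensor_map_comp.
  rewrite -comp_lfunA [X in (_ \o X)%VF]comp_lfunA -phiD.
  by rewrite -comp_lfunA phiphiV comp_lfun1r.
Qed.

Definition kac_autT (K : kac_data) := {phi | phi \in kac_aut K}.

(* The group law is composition: (u * v) x = u (v x). *)
Section AutGroup.
Variable K : kac_data.
Implicit Types u v w : kac_autT K.

HB.instance Definition _ := SubType.on (kac_autT K).
HB.instance Definition _ := Choice.on (kac_autT K).

Definition kac_aut_one : kac_autT K :=
  exist (fun phi => phi \in kac_aut K) _ (kac_aut1 K).
Definition kac_aut_inv u : kac_autT K :=
  exist (fun phi => phi \in kac_aut K) _ (kac_autV (valP u)).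
Definition kac_aut_mul u v : kac_autT K :=
  exist (fun phi => phi \in kac_aut K) _ (kac_autM (valP u) (valP v)).

Fact kac_aut_mulA : associative kac_aut_mul.
Proof. by move=> u v w; apply: val_inj; rewrite /= comp_lfunA. Qed.

Fact kac_aut_mul1g : left_id kac_aut_one kac_aut_mul.
Proof. by move=> u; apply: val_inj; rewrite /= comp_lfun1l. Qed.

Fact kac_aut_mulg1 : right_id kac_aut_one kac_aut_mul.
Proof. by move=> u; apply: val_inj; rewrite /= comp_lfun1r. Qed.

Fact kac_aut_mulVg : left_inverse kac_aut_one kac_aut_inv kac_aut_mul.
Proof.
move=> u; apply: val_inj; rewrite /= lker0_compVf //.
by have /set_mem[] := valP u.
Qed.

Fact kac_aut_mulgV : right_inverse kac_aut_one kac_aut_inv kac_aut_mul.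
Proof.
move=> u; apply: val_inj; rewrite /= lker0_compfV //.
by have /set_mem[] := valP u.
Qed.

HB.instance Definition _ := isGroup.Build (kac_autT K)
  kac_aut_mulA kac_aut_mul1g kac_aut_mulg1 kac_aut_mulVg kac_aut_mulgV.

End AutGroup.
End KacData.

Section Ahom.
Variables (C : numClosedFieldType) (G : finGroupType) (A : falgType C).

Lemma lin_ext_ahom (f : G -> A) :
  f 1%g = 1 -> {morph f : g h / (g * h)%g >-> g * h} ->
  ahom_in fullv (lin_ext f : 'Hom(galg C G, A)).
Proof.
move=> f1 fM; apply/ahom_inP; split=> [x y _ _|]; last first.
  by rewrite -lambda1 lin_ext_lambda.
rewrite {1}[x]galg_basis mulr_suml linear_sum [lin_ext f x]lin_extE mulr_suml.
apply: eq_bigr => g _; rewrite -scalerAl linearZ /= -scalerAl.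
congr (_ *: _); rewrite {1}[y]galg_basis mulr_sumr linear_sum /=.
rewrite [lin_ext f y]lin_extE mulr_sumr; apply: eq_bigr => h _.
by rewrite -scalerAr linearZ /= -lambdaM lin_ext_lambda fM scalerAr.
Qed.

Lemma ahom_gen_inj (s : seq G) (f1 f2 : 'Hom(galg C G, A)) :
  <<[set g in s]>>%g = [set: G] -> ahom_in fullv f1 -> ahom_in fullv f2 ->
  {in s, forall g, f1 (lambda C g) = f2 (lambda C g)} -> f1 = f2.
Proof.
move=> sG /ahom_inP[f1M f11] /ahom_inP[f2M f21] f12.
apply: lfun_lambdaP => g; have : g \in <<[set g in s]>>%g by rewrite sG inE.
case/gen_prodgP => m [t ts ->]; elim: m t ts => [|m IHm] t ts.
  by rewrite big_ord0 lambda1 f11 f21.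
rewrite big_ord_recl lambdaM f1M ?memvf // f2M ?memvf //.
congr (_ * _); first by apply: f12; have := ts ord0; rewrite inE.
by apply: (IHm (t \o lift ord0)) => i; apply: ts.
Qed.

End Ahom.

Section Dihedral.
Variables (G : finGroupType) (n : nat) (a b : G).

(* a and b generate the group and satisfy the relations of
   < a, b | a^2n = b^2 = 1, b a = a^-1 b >; the order condition makes this
   a presentation. *)
Definition dihedral_gens : Prop :=
  [/\ <<[set a; b]>> = [set: G], #|G| = (4 * n)%N,
      a ^+ (2 * n) = 1, b ^+ 2 = 1 & b * a = a^-1 * b]%g.

Hypothesis Gab : dihedral_gens.

Lemma dihedral_n_gt0 : (0 < n)%N.
Proof.
case: Gab => _ cG _ _ _; rewrite lt0n; apply/eqP => n0.
have : (0 < #|G|)%N by apply/card_gt0P; exists 1%g.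
by rewrite cG n0 muln0.
Qed.

Let N_gt0 : (0 < 2 * n)%N. Proof. by rewrite muln_gt0 dihedral_n_gt0. Qed.

Lemma dihedral_surj g :
  exists i : 'I_(2 * n), exists j : bool, g = (a ^+ i * b ^+ j)%g.
Proof.
case: Gab => genG _ a1 b1 ba.
have nba : <[b]>%g \subset 'N(<[a]>)%g.
  rewrite cycle_subG; apply/normP; rewrite -cycleJ.
  suff -> : (a ^ b = a^-1)%g by rewrite cycleV.
  have bV : (b^-1 = b)%g by apply: (mulgI b); rewrite mulgV -b1 expg2.
  by rewrite conjgE bV mulgA ba -mulgA -expg2 b1 mulg1.
have : g \in (<[a]> * <[b]>)%g.
  by rewrite -norm_joinEr // joing_idl joing_idr [(_ <*> _)%g]genG inE.
case/mulsgP => _ _ /cycleP[i ->] /cycleP[j ->] ->.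
exists (Ordinal (ltn_pmod i N_gt0)), (odd j).
by rewrite /= -modn2 !expg_mod.
Qed.

Lemma dihedral_inj (i k : 'I_(2 * n)) (j l : bool) :
  (a ^+ i * b ^+ j = a ^+ k * b ^+ l)%g -> (i, j) = (k, l).
Proof.
pose f (p : 'I_(2 * n) * bool) := (a ^+ p.1 * b ^+ p.2)%g.
have : {in predT &, injective f}.
  apply/image_injP/eqP; rewrite card_prod card_ord card_bool.
  case: Gab => _ cG _ _ _; rewrite [RHS]mulnC mulnA -cG; apply/eq_card => g.
  have [i0 [j0 ->]] := dihedral_surj g.
  by rewrite [RHS]inE; apply/fintype.imageP; exists (i0, j0).
by move=> finj e; apply: finj.
Qed.

End Dihedral.

Section DihedralExtension.
Variables (C : numClosedFieldType) (G : finGroupType) (n : nat) (a b : G).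
Variable A : falgType C.
Implicit Types x y : A.

(* The algebra morphism lambda a |-> x, lambda b |-> y: the linear extension
   of a^i b^j |-> x^i y^j for i < 2n, j < 2.  It is multiplicative when
   x and y satisfy the dihedral relations (dihedral_ext_ahom). *)
Definition dihedral_ext x y : 'Hom(galg C G, A) :=
  lin_ext (fun g : G =>
    if [pick p : 'I_(2 * n) * bool | g == (a ^+ p.1 * b ^+ p.2)%g] is Some p
    then x ^+ p.1 * y ^+ p.2 else 0).

Hypothesis Gab : dihedral_gens n a b.
Variables x y : A.
Hypotheses (x1 : x ^+ (2 * n) = 1) (y1 : y ^+ 2 = 1).
Hypothesis yx : y * x = x ^+ (2 * n).-1 * y.

Lemma dihedral_ext_lambda i j :
  dihedral_ext x y (lambda C (a ^+ i * b ^+ j)%g) = x ^+ i * y ^+ j.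
Proof.
have [_ _ a1 b1 _] := Gab; have n_gt0 := dihedral_n_gt0 Gab.
have N_gt0 : (0 < 2 * n)%N by rewrite muln_gt0.
have -> : x ^+ i * y ^+ j = x ^+ (i %% (2 * n)) * y ^+ odd j.
  rewrite {1}(divn_eq i (2 * n)) exprD mulnC exprM x1 expr1n mul1r.
  by rewrite -{1}(odd_double_half j) exprD -mul2n exprM y1 expr1n mulr1.
rewrite lin_ext_lambda; case: pickP => [[k l] /= /eqP|/(_ (Ordinal (ltn_pmod i N_gt0), odd j))].
  rewrite -(expg_mod i a1) -(expg_mod j b1) modn2.
  by move/(dihedral_inj Gab (i := Ordinal (ltn_pmod i N_gt0))) => [<- <-].
by rewrite /= -modn2 !expg_mod // eqxx.
Qed.

Lemma dihedral_ext_ahom : ahom_in fullv (dihedral_ext x y).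
Proof.
have [_ _ a1 b1 ba] := Gab; have n_gt0 := dihedral_n_gt0 Gab.
have N_gt0 : (0 < 2 * n)%N by rewrite muln_gt0.
have ba' : (b * a = a ^+ (2 * n).-1 * b)%g.
  rewrite ba; congr (_ * _)%g; apply: (mulIg a).
  by rewrite mulVg -expgSr prednK.
have bak k : (b * a ^+ k = a ^+ ((2 * n).-1 * k) * b)%g.
  elim: k => [|k IHk]; first by rewrite muln0 mulg1 mul1g.
  by rewrite expgSr mulgA IHk -mulgA ba' mulgA -expgD mulnSr.
have yxk k : y * x ^+ k = x ^+ ((2 * n).-1 * k) * y.
  elim: k => [|k IHk]; first by rewrite muln0 mulr1 mul1r.
  by rewrite exprSr mulrA IHk -mulrA yx mulrA -exprD mulnSr.
have dlam := dihedral_ext_lambda.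
have extE g : dihedral_ext x y (lambda C g) = _ := lin_ext_lambda _ _.
apply: lin_ext_ahom => [|g h]; rewrite -!extE.
  by have := dlam 0 0; rewrite !mulg1 mulr1.
have [i [j ->]] := dihedral_surj Gab g; have [k [l ->]] := dihedral_surj Gab h.
rewrite !dlam; case: j => /=.
  rewrite -mulgA [(b * _)%g]mulgA bak -mulgA mulgA -expgD -[(b * _)%g]expgS.
  by rewrite dlam exprD exprS -!mulrA [X in _ = _ * X]mulrA yxk !mulrA.
by rewrite mulg1 mulgA -expgD dlam exprD mulr1 mulrA.
Qed.

End DihedralExtension.

Section KD.
Variables (C : numClosedFieldType) (G : finGroupType) (n : nat) (a b : G).

Definition kd_nu : C := - 1 + 2 * 'i.

Definition kd_h (i : 'I_4) : G :=
  nth 1%g [:: 1; a ^+ n; b; b * a ^+ n]%g i.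

Definition kd_c (i j : 'I_4) : C :=
  8^-1 * nth 0 (nth [::]
    [:: [:: 5; 1;       1;       1      ];
        [:: 1; 1;       kd_nu^*; kd_nu  ];
        [:: 1; kd_nu;   1;       kd_nu^*];
        [:: 1; kd_nu^*; kd_nu;   1      ]] i) j.

Definition kd_Omega : galg C (G * G)%type :=
  \sum_i \sum_j kd_c i j *: tensor (lambda C (kd_h i)) (lambda C (kd_h j)).

Definition comult_s : 'Hom(galg C G, galg C (G * G)%type) :=
  lin_ext (fun g : G => tensor (lambda C g) (lambda C g)).

Definition KD : kac_data C G := {|
  comult := (amulr (star kd_Omega) \o amull kd_Omega \o comult_s)%VF;
  counit := lin_ext (fun _ : G => 1 : C^o);
  antipode := lin_ext (fun g : G => lambda C g^-1%g)
|}.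

Lemma KD_comultE x :
  comult KD x = kd_Omega * comult_s x * star kd_Omega.
Proof. by rewrite /KD /= !comp_lfunE /= !lfunE. Qed.

(* ThetaP and Theta'P below, with ahom_gen_inj for uniqueness, identify these
   as the algebra morphisms with the prescribed values on the generators. *)
Definition Theta (k : nat) : 'End(galg C G) :=
  dihedral_ext n a b (lambda C (a ^+ k)%g) (lambda C b).

Definition Theta' : 'End(galg C G) :=
  dihedral_ext n a b
    (lambda C a - 2^-1 *: ((lambda C a - lambda C a^-1%g)
                           * (1 + lambda C (a ^+ n)%g)))
    (lambda C (a ^+ n * b)%g).

Definition A2n : set 'End(galg C G) :=
  [set phi | exists k, coprime k (2 * n)
                       /\ (phi = Theta k \/ phi = (Theta k \o Theta')%VF)]%classic.

Hypothesis Gab : dihedral_gens n a b.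

Lemma lambdaX (g : G) k : lambda C (g ^+ k)%g = lambda C g ^+ k.
Proof. by elim: k => // k IHk; rewrite expgS exprS lambdaM IHk. Qed.

Lemma dihedral_ext_gens (x y : galg C G) :
    x ^+ (2 * n) = 1 -> y ^+ 2 = 1 -> y * x = x ^+ (2 * n).-1 * y ->
  [/\ ahom_in fullv (dihedral_ext n a b x y),
      dihedral_ext n a b x y (lambda C a) = x
    & dihedral_ext n a b x y (lambda C b) = y].
Proof.
move=> x1 y1 yx; split; first exact: dihedral_ext_ahom.
  have := dihedral_ext_lambda Gab x1 y1 1 0.
  by rewrite expg1 expg0 mulg1 expr1 expr0 mulr1.
have := dihedral_ext_lambda Gab x1 y1 0 1.
by rewrite expg1 expg0 mul1g expr1 expr0 mul1r.
Qed.

Let N_gt0 : (0 < 2 * n)%N. Proof. by rewrite muln_gt0 (dihedral_n_gt0 Gab). Qed.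

Let aX2n : (a ^+ (2 * n) = 1)%g. Proof. by case: Gab. Qed.

Let aV : (a ^+ (2 * n).-1 = a^-1)%g.
Proof. by apply: (mulIg a); rewrite mulVg -expgSr prednK. Qed.

Let baX k : (b * a ^+ k = a^-1 ^+ k * b)%g.
Proof.
elim: k => [|k IHk]; first by rewrite mulg1 mul1g.
have [_ _ _ _ ba] := Gab.
by rewrite expgSr mulgA IHk -mulgA ba mulgA -expgSr.
Qed.

Let baV : (b * a^-1 = a * b)%g.
Proof. by rewrite -aV baX expgVn aV invgK. Qed.

Lemma ThetaP k :
  [/\ ahom_in fullv (Theta k), Theta k (lambda C a) = lambda C (a ^+ k)%g
    & Theta k (lambda C b) = lambda C b].
Proof.
have [_ _ a1 b1 ba] := Gab; apply: dihedral_ext_gens.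
- by rewrite -lambdaX -expgM mulnC expgM a1 expg1n.
- by rewrite -lambdaX b1.
- by rewrite -lambdaX -!lambdaM baX -expgM mulnC expgM aV.
Qed.

Lemma Theta'P :
  [/\ ahom_in fullv Theta',
      Theta' (lambda C a)
        = lambda C a - 2^-1 *: ((lambda C a - lambda C a^-1%g)
                                * (1 + lambda C (a ^+ n)%g))
    & Theta' (lambda C b) = lambda C (a ^+ n * b)%g].
Proof.
have [_ _ a1 b1 ba] := Gab.
have an2 : (a ^+ n * a ^+ n = 1)%g by rewrite -expgD addnn -mul2n.
have anV : (a^-1 ^+ n = a ^+ n)%g.
  by apply: (mulIg (a ^+ n)%g); rewrite an2 expgVn mulVg.
set la := lambda C a; set lv := lambda C a^-1%g; set ln := lambda C (a ^+ n)%g.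
pose p := 2^-1 *: (1 + ln); pose q := 1 - p.
have two : 2 != 0 :> C by rewrite pnatr_eq0.
have lnn : ln * ln = 1 by rewrite -lambdaM an2.
have pp : p * p = p.
  rewrite /p -scalerAl -scalerAr mulrDl !mulrDr !mul1r !mulr1 lnn.
  rewrite [ln + 1]addrC scalerA -mulr2n -scaler_nat scalerA -mulrA mulVf //.
  by rewrite mulr1.
have pq : p * q = 0 by rewrite mulrBr mulr1 pp subrr.
have qp : q * p = 0 by rewrite mulrBl mul1r pp subrr.
have qq : q * q = q by rewrite {1}/q mulrBl mul1r pq subr0.
have comp (z : galg C G) : z * ln = ln * z -> z * p = p * z.
  by move=> zn; rewrite -scalerAl -scalerAr mulrDl mulrDr mulr1 mul1r zn.
have cla : la * p = p * la.
  by apply: comp; rewrite -!lambdaM -expgS -expgSr.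
have clv : lv * p = p * lv.
  by apply: comp; rewrite -!lambdaM -anV -expgS -expgSr.
have cq (z : galg C G) : z * p = p * z -> z * q = q * z.
  by move=> zp; rewrite mulrBr mulrBl mulr1 mul1r zp.
pose x := la * q + lv * p.
have xE : la - 2^-1 *: ((la - lv) * (1 + ln)) = x.
  by rewrite scalerAr -/p /x /q mulrBl mulrBr mulr1 opprB addrAC addrA.
have qp1 : q + p = 1 by rewrite subrK.
clearbody q.
have xX k : x ^+ k = la ^+ k * q + lv ^+ k * p.
  elim: k => [|k IHk]; first by rewrite !expr0 !mul1r qp1.
  have cX (u v : galg C G) : v * u = u * v -> u * v ^+ k = v ^+ k * u.
    by move=> uv; apply: commrX.
  have h1 : q * (la ^+ k * q) = la ^+ k * q.
    by rewrite mulrA (cX _ _ (cq _ cla)) -mulrA qq.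
  have h2 : q * (lv ^+ k * p) = 0 by rewrite mulrA (cX _ _ (cq _ clv)) -mulrA qp mulr0.
  have h3 : p * (la ^+ k * q) = 0 by rewrite mulrA (cX _ _ cla) -mulrA pq mulr0.
  have h4 : p * (lv ^+ k * p) = lv ^+ k * p by rewrite mulrA (cX _ _ clv) -mulrA pp.
  rewrite exprS IHk /x mulrDl !mulrDr -!mulrA h1 h2 h3 h4 !mulr0 addr0 add0r.
  by rewrite !mulrA -!exprS.
have lalv : la ^+ (2 * n).-1 = lv by rewrite -lambdaX aV.
have lvla : lv ^+ (2 * n).-1 = la by rewrite -lambdaX expgVn aV invgK.
rewrite /Theta' -/la -/lv -/ln xE; apply: dihedral_ext_gens.
- by rewrite xX -!lambdaX expgVn a1 invg1 lambda1 !mul1r qp1.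
- by rewrite -lambdaX expg2 mulgA -[(_ * b * _)%g]mulgA baX anV mulgA an2
             mul1g -expg2 b1.
rewrite xX lalv lvla /x.
set y := lambda C _.
have yn : y * ln = ln * y.
  by rewrite -!lambdaM -[in LHS]mulgA baX anV mulgA.
have yp : y * p = p * y by apply: comp.
have anVa : (a ^+ n * a^-1 = a^-1 * a ^+ n)%g.
  by rewrite -anV -expgS -expgSr.
have yla : y * la = lv * y.
  by rewrite -!lambdaM -mulgA ba !mulgA anVa.
have ylv : y * lv = la * y.
  by rewrite -!lambdaM -mulgA baV !mulgA -expgS -expgSr.
rewrite mulrDr mulrDl !mulrA yla ylv -!mulrA (cq y) //.
by rewrite yp.
Qed.

End KD.

Arguments A2n C {G} n a b.

Lemma dihedral_gens_exists n : (0 < n)%N ->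
  exists a b : 'D_(4 * n), dihedral_gens n a b.
Proof.
move=> n_gt0; have m2 : (4 * n = (2 * n).*2)%N by rewrite -mul2n mulnA.
have n2_gt1 : (1 < 2 * n)%N by case: n n_gt0 {m2} => // n _; rewrite mulnS.
rewrite /dihedral_gens m2.
have cD := card_dihedral n2_gt1.
have /existsP[[a b] /eqP[genD a1 b1 ab]] := isoGrp_hom (Grp_dihedral n2_gt1).
have bV : (b^-1 = b)%g by apply: (mulgI b); rewrite mulgV -b1 expg2.
exists a, b; split=> //; first by rewrite -genD joing_idl joing_idr.
  by rewrite -cardsT cD.
by rewrite -ab conjgE bV -!mulgA -expg2 b1 mulg1.
Qed.

(* Main.v *)
Require Import Defs.
From HB Require Import structures.
From mathcomp Require Import all_boot all_order all_algebra all_fingroup.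
From mathcomp Require Import all_solvable all_field.
From mathcomp Require Import boolp classical_sets functions cardinality reals.
From mathcomp Require Import complex.
From mathcomp Require Import ring.

Set Implicit Arguments.
Unset Strict Implicit.
Unset Printing Implicit Defensive.

Import Order.TTheory GRing.Theory Num.Theory.
Local Open Scope ring_scope.

(** Write c = a^n and H = {1, c, b, bc}.  Since the coefficients of Omega
    satisfy conj (c_ij) = c_ji, the adjoint of Omega is its flip; it is also
    the image of Omega under the exchange of b and bc.  Moreover Omega is
    unitary, and its square R is, up to the factor 1/4, the nondegenerate
    alternating bicharacter of H, with values 1 and -1 ([twist_sqr]).

    An automorphism permutes the group-like elements, among which are those of
    H.  Let u be an invertible group-like element, so that
    Omega (Ds u) Omega^* = u (x) u, where Ds is the untwisted coproduct.
    Flipping this equality shows that Ds u commutes with R, and comparing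
    coefficients shows that u (1 - c) is supported in the normaliser of H
    ([group_like_off_normaliser]); as u is also supported in one double coset
    of H, its support lies in H or in the other coset of H in the normaliser
    ([group_like_coset]).  In the first case u belongs to H
    ([group_like_in_v4]).  In the second, conjugation by the support turns
    Omega^* into Omega, so that R (Ds u) = u (x) u ([group_like_off_v4]), a
    small quadratic system for four coefficients.

    Centrality excludes the second case for the image of c, which is therefore
    c ([kac_aut_c]).  The image u of b is an involution; in the second case
    the quadratic system would make u (1 + c) central, although b (1 + c) is
    not when n >= 3.  Hence b goes to b or bc ([kac_aut_b]).  After composing
    with Theta', which exchanges b and bc, the automorphism fixes H pointwise,
    hence Omega; it then preserves Ds, maps the group to itself, and is some
    Theta_k ([kac_aut_fix_v4]).

    Conversely, Theta_k fixes Omega and permutes the group.  Theta' maps Omega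
    to Omega^*, and the compatibility with the coproduct at a reduces to
    R (Ds x) = (x (x) x) R for x = Theta' a ([rmat_Theta'_a]), which is checked
    on the blocks cut out by the idempotents (1 + c)/2 and (1 - c)/2.
    Finally Theta' is an involution commuting with all Theta_k, and Theta_k
    depends only on k modulo 2n, so the group is the product of the units of
    Z/2n with Z/2. *)

(** * Group algebras *)

Section GroupAlgebraFacts.
Variables (C : numClosedFieldType) (G : finGroupType).
Implicit Types (u v w : galg C G) (g h x y : G).

Lemma lambda_mulE g w x : (lambda C g * w) x = w (g^-1 * x)%g.
Proof.
rewrite galg_mulE (bigD1 g) //= ffunE eqxx mul1r big1 ?addr0 // => h hg.
by rewrite ffunE (negPf hg) mul0r.
Qed.

Lemma mul_lambdaE g w x : (w * lambda C g) x = w (x * g^-1)%g.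
Proof.
rewrite galg_mulE (bigD1 (x * g^-1)%g) //= ffunE invMg invgK -mulgA mulVg.
rewrite mulg1 eqxx mulr1 big1 ?addr0 // => h hx; rewrite ffunE.
case: eqP => [E|_]; last by rewrite mulr0.
by case/eqP: hx; rewrite -E invMg invgK mulgA mulgV mul1g.
Qed.

Lemma lambda_inj : injective (lambda C (G := G)).
Proof.
move=> g h /ffunP/(_ g); rewrite !ffunE eqxx; case: eqP => // _ /eqP.
by rewrite oner_eq0.
Qed.

Lemma lambda_neq0 g : lambda C g != 0.
Proof.
by apply/eqP=> /ffunP/(_ g)/eqP; rewrite !ffunE eqxx oner_eq0.
Qed.

Lemma comult_s_lambda g : comult_s C G (lambda C g) = lambda C (g, g).
Proof. by rewrite lin_ext_lambda tensor_lambda. Qed.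

Lemma comult_sE u x y : comult_s C G u (x, y) = if x == y then u x else 0.
Proof.
rewrite lin_extE sum_ffunE (bigD1 x) //= tensor_lambda !ffunE big1 ?addr0.
  rewrite xpair_eqE eqxx /= eq_sym; case: eqP => _.
    by rewrite /GRing.scale /= mulr1.
  by rewrite scaler0.
move=> g gx; rewrite tensor_lambda !ffunE xpair_eqE eq_sym (negPf gx).
by rewrite scaler0.
Qed.

Lemma tensorE u v x y : tensor u v (x, y) = u x * v y.
Proof. by rewrite ffunE. Qed.

Lemma starM u v : star (u * v) = star v * star u.
Proof.
apply/ffunP=> g; rewrite ffunE !galg_mulE rmorph_sum /=.
rewrite (reindex_inj (mulgI g^-1)%g) /=.
apply: eq_bigr => h _; rewrite !ffunE rmorphM mulrC.
by rewrite !invMg !invgK -!mulgA mulgV mulg1.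
Qed.

Lemma star_sum (I : Type) (r : seq I) (F : I -> galg C G) :
  star (\sum_(i <- r) F i) = \sum_(i <- r) star (F i).
Proof.
by apply/ffunP=> g; rewrite !(ffunE, sum_ffunE) rmorph_sum;
  apply: eq_bigr => i _; rewrite ffunE.
Qed.

Lemma starZ (k : C) u : star (k *: u) = k^* *: star u.
Proof. by apply/ffunP=> g; rewrite !ffunE rmorphM. Qed.

Lemma comult_s_ahom : ahom_in fullv (comult_s C G).
Proof.
apply: lin_ext_ahom => [|g h]; first by rewrite tensor_lambda lambda1.
by rewrite -tensorM !lambdaM.
Qed.

Lemma tensor_map_ahom (phi : 'End(galg C G)) :
  ahom_in fullv phi -> ahom_in fullv (tensor_map phi).
Proof.
move=> /ahom_inP[phiM phi1]; apply: lin_ext_ahom => [|[g h] [g' h']] /=.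
  by rewrite !phi1; apply/ffunP=> -[x y]; rewrite !ffunE xpair_eqE -natrM mulnb.
by rewrite -tensorM -!phiM ?memvf // -!lambdaM.
Qed.

(** Compare coefficients at (x, y): [u x * u y] vanishes off the diagonal and
    is [u x] on it, so a single coefficient survives and it is 1. *)
Lemma comult_s_group_like u :
  u != 0 -> comult_s C G u = tensor u u -> exists x, u = lambda C x.
Proof.
move=> u0 uG; have [x ux] : exists x, u x != 0.
  apply/existsP; rewrite -negb_forall; apply: contraNN u0 => /forallP u0.
  by apply/eqP/ffunP=> x; rewrite ffunE; apply/eqP.
exists x; apply/ffunP=> y; rewrite ffunE.
have : comult_s C G u (x, y) = tensor u u (x, y) by rewrite uG.
rewrite comult_sE tensorE eq_sym; case: eqP => [-> /eqP|_ /esym/eqP].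
  by rewrite -subr_eq0 -{1}[u x]mulr1 -mulrBr mulf_eq0 (negPf ux) subr_eq0 =>
    /eqP.
by rewrite mulf_eq0 (negPf ux) => /eqP.
Qed.

Definition flip (w : galg C (G * G)%type) : galg C (G * G)%type :=
  [ffun p => w (p.2, p.1)].

Lemma flipM (w w' : galg C (G * G)%type) : flip (w * w') = flip w * flip w'.
Proof.
apply/ffunP=> -[x y]; rewrite ffunE !galg_mulE.
rewrite (reindex_inj (h := fun p : G * G => (p.2, p.1))) /=; last first.
  by move=> [? ?] [? ?] [-> ->].
by apply: eq_bigr => -[g h] _; rewrite !ffunE.
Qed.

Lemma flip1 : flip 1 = 1.
Proof. by apply/ffunP=> -[x y]; rewrite !ffunE !xpair_eqE andbC. Qed.

Lemma flip_tensor u v : flip (tensor u v) = tensor v u.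
Proof. by apply/ffunP=> -[x y]; rewrite !ffunE mulrC. Qed.

Lemma flip_comult_s u : flip (comult_s C G u) = comult_s C G u.
Proof.
apply/ffunP=> -[x y]; rewrite ffunE !comult_sE /= eq_sym.
by case: eqP => // ->.
Qed.

End GroupAlgebraFacts.

(** * The Klein four-group and its twist *)

Section Klein.
Variables (C : numClosedFieldType) (G : finGroupType) (c b : G).
Hypotheses (cc : (c * c = 1)%g) (bb : (b * b = 1)%g) (cb : (c * b = b * c)%g).
Hypotheses (c1 : c != 1%g) (b1 : b != 1%g) (bc : b != c).

Local Notation V4 := (bool * bool)%type.
Implicit Types (s t : V4) (f g : V4 -> V4 -> C) (u : galg C G) (x y : G).

(** Indexing the Klein four-group by pairs of booleans turns its group law into
    exclusive or, so that identities in the group algebra of its square become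
    sixteen equations between coefficients. *)
Definition v4 s : G := (b ^+ s.1 * c ^+ s.2)%g.
Definition v4_add s t : V4 := (s.1 (+) t.1, s.2 (+) t.2).

Lemma v4_addA s t r : v4_add s (v4_add t r) = v4_add (v4_add s t) r.
Proof. by rewrite /v4_add /= !addbA. Qed.
Lemma v4_addC s t : v4_add s t = v4_add t s.
Proof. by rewrite /v4_add addbC (addbC s.2). Qed.
Lemma v4_addK s t : v4_add (v4_add t s) s = t.
Proof. by rewrite /v4_add /= !addbK; case: t. Qed.
Lemma v4_addKl s t : v4_add s (v4_add s t) = t.
Proof. by rewrite /v4_add /= !addKb; case: t. Qed.
Lemma v4_add_inj s : injective (v4_add s).
Proof. exact: can_inj (v4_addKl s). Qed.

Lemma v4M s t : (v4 s * v4 t = v4 (v4_add s t))%g.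
Proof.
have addX (z : G) (x y : bool) : (z * z = 1 -> z ^+ x * z ^+ y = z ^+ (x (+)
  y))%g.
  by case: x y => [] [] zz; rewrite /= ?expg0 ?expg1 ?mulg1 ?mul1g ?zz.
have cbX : (c ^+ s.2 * b ^+ t.1 = b ^+ t.1 * c ^+ s.2)%g.
  exact: (commuteX2 _ _ cb).
by rewrite /v4 mulgA -[X in (X * _)%g]mulgA cbX mulgA addX // -mulgA addX.
Qed.

Lemma v4V s : ((v4 s)^-1 = v4 s)%g.
Proof.
apply: (mulgI (v4 s)); rewrite mulgV v4M /v4_add !addbb.
by rewrite /v4 mulg1.
Qed.

Lemma v4_eq1 s : (v4 s == 1%g) = (s == (false, false)).
Proof.
case: s => [[] []]; rewrite /v4 /= ?mulg1 ?mul1g ?eqxx ?expg1 ?(negPf c1)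
  ?(negPf b1) //.
by rewrite -(inj_eq (mulgI b)) mulgA bb mul1g mulg1 eq_sym (negPf bc).
Qed.

Lemma v4_inj : injective v4.
Proof.
move=> s t /(congr1 (fun z => z * v4 t)%g); rewrite !v4M.
have -> : v4_add t t = (false, false) by rewrite /v4_add !addbb.
rewrite [RHS](_ : _ = 1%g); last by rewrite /v4 mulg1.
move/eqP; rewrite v4_eq1 => /eqP E.
by rewrite -[s](v4_addK t) E /v4_add; case: t {E} => [[] []].
Qed.

Definition v4_elt f : galg C (G * G)%type :=
  \sum_s \sum_t f s t *: lambda C (v4 s, v4 t).

Lemma v4_elt_mulE f (w : galg C (G * G)%type) x y :
  (v4_elt f * w) (x, y) = \sum_s \sum_t f s t * w (v4 s * x, v4 t * y)%g.
Proof.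
rewrite mulr_suml sum_ffunE; apply: eq_bigr => s _.
rewrite mulr_suml sum_ffunE; apply: eq_bigr => t _.
rewrite -scalerAl ffunE lambda_mulE /GRing.scale /=; congr (_ * w _).
by rewrite -{2}[v4 s]v4V -{2}[v4 t]v4V.
Qed.

Lemma mul_v4_eltE f (w : galg C (G * G)%type) x y :
  (w * v4_elt f) (x, y) = \sum_s \sum_t f s t * w (x * v4 s, y * v4 t)%g.
Proof.
rewrite mulr_sumr sum_ffunE; apply: eq_bigr => s _.
rewrite mulr_sumr sum_ffunE; apply: eq_bigr => t _.
rewrite -scalerAr ffunE mul_lambdaE /GRing.scale /=; congr (_ * w _).
by rewrite -{2}[v4 s]v4V -{2}[v4 t]v4V.
Qed.

Definition v4_conv f g s t : C :=
  \sum_r \sum_q f r q * g (v4_add r s) (v4_add q t).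

Lemma eq_v4_elt f g : (forall s t, f s t = g s t) -> v4_elt f = v4_elt g.
Proof.
by move=> fg; apply: eq_bigr => s _; apply: eq_bigr => t _; rewrite fg.
Qed.

Lemma v4_elt_lambda f s t :
  v4_elt f * lambda C (v4 s, v4 t)
  = v4_elt (fun r q => f (v4_add s r) (v4_add t q)).
Proof.
rewrite /v4_elt [RHS](reindex_inj (v4_add_inj (s := s))) mulr_suml.
apply: eq_bigr => r _; rewrite [RHS](reindex_inj (v4_add_inj (s := t))).
rewrite mulr_suml; apply: eq_bigr => q _.
rewrite !v4_addKl -scalerAl -lambdaM; congr (_ *: lambda C _).
by congr pair; rewrite v4M v4_addC.
Qed.

Lemma v4_eltM f g : v4_elt f * v4_elt g = v4_elt (v4_conv f g).
Proof.
rewrite [v4_elt g]/v4_elt mulr_sumr.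
under eq_bigr => s _ do
  (rewrite mulr_sumr; under eq_bigr => t _ do
     rewrite -scalerAr v4_elt_lambda /v4_elt scaler_sumr).
have E s t (r : V4) : g s t *: (\sum_q f (v4_add s r) (v4_add t q) *: lambda C
  (v4 r, v4 q))
  = \sum_q (g s t * f (v4_add s r) (v4_add t q)) *: lambda C (v4 r, v4 q).
  by rewrite scaler_sumr; apply: eq_bigr => q _; rewrite scalerA.
under eq_bigr => s _ do (under eq_bigr => t _ do under eq_bigr => r _ do
  rewrite E).
under eq_bigr => s _ do rewrite exchange_big.
rewrite exchange_big; apply: eq_bigr => r _ /=.
under eq_bigr => s _ do rewrite exchange_big.
rewrite exchange_big; apply: eq_bigr => q _ /=.
rewrite /v4_conv scaler_suml (reindex_inj (v4_add_inj (s := r))).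
apply: eq_bigr => s _; rewrite scaler_suml (reindex_inj (v4_add_inj (s := q))).
apply: eq_bigr => t _ /=; rewrite ![v4_add _ s]v4_addC ![v4_add _ t]v4_addC.
rewrite -!v4_addA /v4_add /= !addbb !addbF mulrC.
by case: s t => [? ?] [? ?].
Qed.

Lemma star_v4_elt f : star (v4_elt f) = v4_elt (fun s t => (f s t)^*).
Proof.
rewrite star_sum; apply: eq_bigr => s _; rewrite star_sum;
  apply: eq_bigr => t _.
rewrite starZ star_lambda; congr (_ *: lambda C _).
by rewrite -{2}[v4 s]v4V -{2}[v4 t]v4V.
Qed.

Lemma flip_v4_elt f : flip (v4_elt f) = v4_elt (fun s t => f t s).
Proof.
rewrite /v4_elt exchange_big /=; apply/ffunP=> -[x y]; rewrite ffunE !sum_ffunE.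
apply: eq_bigr => s _; rewrite !sum_ffunE; apply: eq_bigr => t _.
by rewrite !ffunE !xpair_eqE andbC.
Qed.

Lemma v4_elt1 :
  v4_elt (fun s t => ((s == (false, false)) && (t == (false, false)))%:R) = 1.
Proof.
rewrite /v4_elt (bigD1 (false, false)) //= [X in _ + X]big1 ?addr0;
  last by move=> s /negPf s0; rewrite big1 // => t _; rewrite s0 scale0r.
rewrite (bigD1 (false, false)) //= big1 ?addr0 => [|t /negPf t0].
  by rewrite scale1r /v4 /= !mulg1 -lambda1.
by rewrite t0 scale0r.
Qed.

Lemma v4_eltD f g : v4_elt f + v4_elt g = v4_elt (fun s t => f s t + g s t).
Proof.
rewrite /v4_elt -big_split; apply: eq_bigr => s _; rewrite -big_split.
by apply: eq_bigr => t _; rewrite scalerDl.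
Qed.

Lemma v4_eltZ (k : C) f : k *: v4_elt f = v4_elt (fun s t => k * f s t).
Proof.
rewrite scaler_sumr; apply: eq_bigr => s _; rewrite scaler_sumr.
by apply: eq_bigr => t _; rewrite scalerA.
Qed.

End Klein.

Section Twist.
Variables (C : numClosedFieldType) (G : finGroupType) (c b : G).
Hypotheses (cc : (c * c = 1)%g) (bb : (b * b = 1)%g) (cb : (c * b = b * c)%g).

Local Notation V4 := (bool * bool)%type.
Local Notation nu := (kd_nu C).
Implicit Types (s t : V4).

Lemma sum_v4 (V : nmodType) (F : V4 -> V) :
  \sum_s F s = F (false, false) + F (false, true) + F (true, false)
               + F (true, true).
Proof.
rewrite (eq_bigr (fun s => F (s.1, s.2))) => [|[] //].
rewrite -(pair_bigA _ (fun x y => F (x, y))) !big_bool /=.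
by rewrite addrC ![F (_, true) + _]addrC !addrA.
Qed.

(** The cyclic order c, bc, b of the three involutions; the entries nu of the
    coefficient matrix sit at the pairs of consecutive ones. *)
Definition v4_next s : V4 := (s.2, s.1 (+) s.2).

Definition twist_coef s t : C :=
  if (s == (false, false)) && (t == (false, false)) then 5
  else if [|| s == (false, false), t == (false, false) | s == t] then 1
  else if t == v4_next s then nu else nu^*.

(** The nondegenerate alternating bicharacter of the Klein four-group, which
    identifies this group with its dual. *)
Definition v4_sign s t : C := (-1) ^+ ((s.1 && t.2) (+) (s.2 && t.1)).

Definition twist : galg C (G * G)%type := 8^-1 *: v4_elt c b twist_coef.
(** The R-matrix of the twisted coproduct: the flip of the twist is its adjoint,
    that is, its inverse, so the quotient of the twist by its flip is the
    square of the twist ([twist_sqr]). *)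
Definition rmat : galg C (G * G)%type := 4^-1 *: v4_elt c b v4_sign.

Lemma nu_conj : nu^* = -1 - 2 * 'i :> C.
Proof. by rewrite /kd_nu rmorphD rmorphN rmorphM rmorph1 rmorph_nat /= conjCi
  mulrN. Qed.

Lemma twist_coef_conj s t : (twist_coef s t)^* = twist_coef t s.
Proof.
case: s t => [[] []] [[] []];
  rewrite /twist_coef /= ?conjC1 ?conjCK ?conjC_nat //.
Qed.

(** Fixing [c] and exchanging [b] with [bc] reverses the cyclic order of the
    involutions.  This is how conjugation by a rotation with square [c], and
    the automorphism Theta', act on the twist. *)
Lemma twist_coef_swap s t :
  twist_coef (s.1, s.1 (+) s.2) (t.1, t.1 (+) t.2) = twist_coef t s.
Proof. by case: s t => [[] []] [[] []]. Qed.

Lemma star_twist : star twist = 8^-1 *: v4_elt c b (fun s t => twist_coef t s).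
Proof.
rewrite starZ star_v4_elt // fmorphV rmorph_nat; congr (_ *: _).
by apply: eq_v4_elt => s t; rewrite twist_coef_conj.
Qed.

Lemma flip_twist : flip twist = star twist.
Proof.
rewrite star_twist -flip_v4_elt; apply/ffunP=> p.
by rewrite !(ffunE, sum_ffunE).
Qed.

Lemma flip_star_twist : flip (star twist) = twist.
Proof. by rewrite -flip_twist; apply/ffunP=> -[x y]; rewrite !ffunE. Qed.

Let nunu : nu * nu = -3 - 4 * 'i :> C.
Proof.
have ii : 'i * 'i = -1 :> C by rewrite -expr2 sqrCi.
rewrite /kd_nu -[RHS](_ : 1 - 4 * 'i + 4 * ('i * 'i) = _); last by rewrite ii;
  ring.
by ring.
Qed.

Let nunuc : nu * nu^* = 5 :> C.
Proof.
have ii : 'i * 'i = -1 :> C by rewrite -expr2 sqrCi.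
rewrite nu_conj /kd_nu -[RHS](_ : 1 - 4 * ('i * 'i) = _); last by rewrite ii;
  ring.
by ring.
Qed.

Let nucnu : nu^* * nu = 5 :> C. Proof. by rewrite mulrC nunuc. Qed.

Let nucnuc : nu^* * nu^* = -3 + 4 * 'i :> C.
Proof.
by rewrite -rmorphM nunu rmorphB rmorphN rmorphM !rmorph_nat /= conjCi mulrN
  opprK.
Qed.

Lemma twist_sqr : twist * twist = rmat.
Proof.
rewrite /twist /rmat -scalerAl -scalerAr scalerA v4_eltM // !v4_eltZ.
apply: eq_v4_elt => s t; rewrite /v4_conv !sum_v4.
case: s t => [[] []] [[] []]; rewrite /twist_coef /v4_sign /=
  ?(mul1r, mulr1, nunu, nunuc, nucnu, nucnuc) ?nu_conj /kd_nu.
all: by field.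
Qed.

Lemma twist_unitary : twist * star twist = 1.
Proof.
rewrite star_twist /twist -scalerAl -scalerAr scalerA v4_eltM // !v4_eltZ.
rewrite -(v4_elt1 C c b); apply: eq_v4_elt => s t; rewrite /v4_conv !sum_v4.
case: s t => [[] []] [[] []]; rewrite /twist_coef /=
  ?(mul1r, mulr1, nunu, nunuc, nucnu, nucnuc) ?nu_conj /kd_nu.
all: by field.
Qed.

Lemma star_twist_unitary : star twist * twist = 1.
Proof.
by rewrite -flip1 -twist_unitary flipM flip_star_twist flip_twist.
Qed.

End Twist.

(** * Group-like elements of the twisted group algebra *)

Section GroupLike.
Variables (C : numClosedFieldType) (G : finGroupType) (c b : G).
Hypotheses (cc : (c * c = 1)%g) (bb : (b * b = 1)%g).
Hypothesis cZ : forall x, (c * x = x * c)%g.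
Hypotheses (c1 : c != 1%g) (b1 : b != 1%g) (bc : b != c).
Hypothesis b_centr : forall x, (b ^ x = b)%g -> exists s, x = v4 c b s.

Local Notation V4 := (bool * bool)%type.
Local Notation nu := (kd_nu C).
Local Notation h := (v4 c b).
Local Notation twist := (twist C c b).
Local Notation rmat := (rmat C c b).
Local Notation Ds := (comult_s C G).
Implicit Types (s t r : V4) (u : galg C G) (x y g : G).

Definition group_like u := twist * Ds u * star twist = tensor u u.

Let hM := v4M cc bb (cZ b).
Let h_inj := v4_inj cc bb (cZ b) c1 b1 bc.

(** Flip both sides of the definition: [tensor u u] is symmetric, and flipping
    the twist inverts it. *)
Lemma group_like_commute u : group_like u -> rmat * Ds u = Ds u * rmat.
Proof.
move=> uG; rewrite -(twist_sqr _ cc bb (cZ b)).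
have: flip (twist * Ds u * star twist) = flip (tensor u u) by rewrite uG.
rewrite !flipM flip_twist // flip_star_twist // flip_comult_s flip_tensor -uG.
move=> /(congr1 (fun w => twist * w * twist)).
rewrite !mulrA twist_unitary // mul1r => ->.
by rewrite -!mulrA star_twist_unitary // mulr1.
Qed.

Lemma rmat_comultE u s x :
  (rmat * Ds u) (x, h s * x)%g
  = 4^-1 * \sum_r v4_sign C r s * u (h r * x)%g.
Proof.
rewrite /rmat -scalerAl ffunE v4_elt_mulE // /GRing.scale /=; congr (_ * _).
apply: eq_bigr => r _; rewrite (bigD1 (v4_add r s)) //= comult_sE mulgA hM.
rewrite v4_addK eqxx big1 ?addr0 => [|q qrs].
  by congr (_ * _); case: r s => [[] []] [[] []].
rewrite comult_sE mulgA hM (inj_eq (mulIg x)) (inj_eq h_inj).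
case: eqP => [E|_]; last by rewrite mulr0.
by case/eqP: qrs; rewrite E v4_addK.
Qed.

Lemma conj_in_v4 x s : (b ^ x = h s -> b ^ x = b \/ b ^ x = b * c)%g.
Proof.
have hx y z : (y ^ x = z -> y = z ^ x^-1)%g by move=> <-; rewrite conjgK.
case: s => [[] []]; rewrite /v4 /= ?mulg1 ?mul1g ?expg1; auto => /hx bE.
  by case/eqP: bc; rewrite bE conjgE cZ mulKg.
by case/eqP: b1; rewrite bE conj1g.
Qed.

Lemma comult_rmat0 u s x : s.1 ->
  (b ^ x != b)%g -> (b ^ x != b * c)%g -> (Ds u * rmat) (x, h s * x)%g = 0.
Proof.
move=> s1 xb xbc; rewrite /rmat -scalerAr ffunE mul_v4_eltE // /GRing.scale /=.
rewrite big1 ?mulr0 // => r _; rewrite big1 // => q _; rewrite comult_sE.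
case: eqP => [E|_]; last by rewrite mulr0.
have {}E : (b ^ x = h (v4_add (false, s.2) (v4_add r q)))%g.
  have E1 : (h s ^ x = h (v4_add r q))%g.
    apply: (mulgI x); apply: (mulIg (h q)).
    by rewrite -conjgC -E -mulgA hM v4_addK.
  have bE : (b = h s * c ^+ s.2)%g.
    case: s s1 {E E1} => [[] [] //]; rewrite /v4 /= ?mulg1 ?expg1 //.
    by rewrite -mulgA cc mulg1.
  rewrite {1}bE conjMg E1 [in RHS]v4_addC -[in RHS]hM; congr (_ * _)%g.
  by rewrite /v4 /= mul1g conjXg conjgE cZ mulKg.
by case: (conj_in_v4 E) => /eqP; [rewrite (negPf xb)|rewrite (negPf xbc)].
Qed.

(** The untwisted comultiplication of a group-like element commutes with
    [rmat].  At a point [(x, h s * x)] with [h s] equal to [b] or [bc] and [x]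
    outside the normaliser of the Klein group, only one of the two products
    has nonzero coefficients; this gives two linear relations on the coset of
    [x], whose sum is the claim. *)
Lemma group_like_off_normaliser u x : group_like u ->
  (b ^ x != b)%g -> (b ^ x != b * c)%g -> u (c * x)%g = u x.
Proof.
move=> /group_like_commute uC xb xbc.
have E s : s.1 -> \sum_r v4_sign C r s * u (h r * x)%g = 0.
  move=> s1; have := rmat_comultE u s x;
    rewrite uC comult_rmat0 // => /esym/eqP.
  by rewrite mulf_eq0 invr_eq0 pnatr_eq0 => /eqP.
have := E (true, false) isT; have := E (true, true) isT.
rewrite !sum_v4 /v4_sign /v4 /= !(expg0, expg1, mul1g, mulg1, mul1r, mulN1r).
have aux (p q r t : C) : p - q - r + t = 0 -> p - q + r - t = 0 -> q = p.
  move=> E1 E2; have /eqP: 2 * (q - p) = 0.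
    transitivity (- ((p - q - r + t) + (p - q + r - t))); first by ring.
    by rewrite E1 E2 addr0 oppr0.
  by rewrite mulf_eq0 pnatr_eq0 subr_eq0 => /eqP.
exact: aux.
Qed.



(** [tensor u u] is obtained from the diagonal element [Ds u] by
    multiplications inside the square of the Klein group, so two points of the
    support of [u] lie in the same double coset of this group. *)
Lemma group_like_support u (P : pred G) x y : group_like u ->
    (forall s z, P (h s * z)%g = P z) -> (forall s z, P (z * h s)%g = P z) ->
  u x != 0 -> u y != 0 -> P x -> P y.
Proof.
move=> uG Pl Pr ux uy Px; apply/idPn => Py.
suff: u x * u y = 0 by move/eqP; rewrite mulf_eq0 (negPf ux) (negPf uy).
rewrite -tensorE -uG star_twist // -scalerAr ffunE mul_v4_eltE // big1.
  by rewrite scaler0.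
move=> s _; rewrite big1 // => t _;
  rewrite /twist -scalerAl ffunE v4_elt_mulE //.
rewrite big1 ?scaler0 ?mulr0 // => s' _; rewrite big1 // => t' _.
rewrite comult_sE; case: eqP => [E|_]; last by rewrite mulr0.
by case/negP: Py; move/(congr1 P): E; rewrite !Pl !Pr Px => <-.
Qed.

Let b_h s : (b ^ h s)%g = b.
Proof.
have: (h (true, false) * h s = h s * h (true, false))%g by rewrite !hM v4_addC.
by rewrite [h (true, false)]/v4 /= mulg1 conjgE => ->; rewrite mulKg.
Qed.

Let c_conj x : (c ^ x = c)%g. Proof. by rewrite conjgE cZ mulKg. Qed.

(** The alternatives say that [u] is supported in the Klein group, or in its
    other coset in the normaliser.  Off the normaliser [u] would be fixed by
    [c], which the second hypothesis excludes; the support lemma separates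
    the two cosets. *)
Lemma group_like_coset u : group_like u -> lambda C c * u != u ->
  (forall x, u x != 0 -> b ^ x = b)%g \/ (forall x, u x != 0 -> b ^ x = b *
    c)%g.
Proof.
move=> uG cu.
have bh s z : (b ^ (h s * z) = b ^ z)%g by rewrite conjgM b_h.
pose P e z := (b ^ z == b * e)%g.
have Pl e s z : P e (h s * z)%g = P e z by rewrite /P bh.
have Pr (e : bool) s z : P (c ^+ e)%g (z * h s)%g = P (c ^+ e)%g z.
  have hE : ((b * c ^+ e) ^ h s = b * c ^+ e)%g by rewrite conjMg conjXg b_h
    c_conj.
  by rewrite /P conjgM -{1}hE (inj_eq (conjg_inj _)).
have cPsupp (e : bool) x : u x != 0 -> P (c ^+ e)%g x ->
    forall y, u y != 0 -> (b ^ y = b * c ^+ e)%g.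
  by move=> ux Px y uy; apply/eqP;
    apply: (group_like_support uG (P := P (c ^+ e)%g)) ux uy Px.
case: (pickP (fun x => (u x != 0) && (P (c ^+ false)%g x))) => [x /andP[ux
  Px]|no1].
  by left=> y uy; rewrite (cPsupp _ _ ux Px) // mulg1.
case: (pickP (fun x => (u x != 0) && (P (c ^+ true)%g x))) => [x /andP[ux
  Px]|no2].
  by right=> y uy; rewrite (cPsupp _ _ ux Px) // expg1.
case/eqP: cu; apply/ffunP=> x; rewrite lambda_mulE.
have -> : (c^-1 = h (false, true))%g.
  by rewrite /v4 /= mul1g expg1; apply: (mulgI c); rewrite mulgV cc.
have z0 (e : bool) y : P (c ^+ e)%g y -> u y = 0.
  by case: e => Py; apply/eqP; [have := no2 y|have := no1 y];
    rewrite Py andbT => /negbFE.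
have [Px|Px1] := boolP (P (c ^+ false)%g x).
  by rewrite (z0 _ _ Px) (z0 false) // Pl.
have [Px|Px2] := boolP (P (c ^+ true)%g x).
  by rewrite (z0 _ _ Px) (z0 true) // Pl.
rewrite /v4 /= mul1g expg1; apply: group_like_off_normaliser => //.
by move: Px1; rewrite /P mulg1.
Qed.

Lemma comult_s_conj u (A B : galg C (G * G)%type) :
  (forall g, u g != 0 -> lambda C (g, g) * A = B * lambda C (g, g)) ->
  Ds u * A = B * Ds u.
Proof.
move=> uAB; rewrite {1 2}(galg_basis u) linear_sum mulr_suml mulr_sumr.
apply: eq_bigr => g _; rewrite linearZ /= comult_s_lambda.
have [->|ug] := eqVneq (u g) 0; first by rewrite !scale0r mul0r mulr0.
by rewrite -scalerAl -scalerAr uAB.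
Qed.

Lemma v4_elt_conj (f : V4 -> V4 -> C) (si : V4 -> V4) g :
  involutive si -> (forall s, g * h s = h (si s) * g)%g ->
  lambda C (g, g) * v4_elt c b f
  = v4_elt c b (fun s t => f (si s) (si t)) * lambda C (g, g).
Proof.
move=> siK gh; rewrite /v4_elt mulr_sumr [in RHS](reindex_inj (inv_inj siK))
  mulr_suml /=.
apply: eq_bigr => s _;
  rewrite mulr_sumr [in RHS](reindex_inj (inv_inj siK)) mulr_suml /=.
apply: eq_bigr => t _; rewrite -scalerAr -scalerAl !siK -!lambdaM.
by congr (_ *: lambda C _); congr pair; rewrite /= gh.
Qed.

(** The Klein group is commutative, so there the twist cancels. *)
Lemma group_like_in_v4 u : group_like u -> u != 0 ->
  (forall x, u x != 0 -> b ^ x = b)%g -> exists s, u = lambda C (h s).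
Proof.
move=> uG u0 ub; have uD : Ds u = tensor u u.
  rewrite -uG -mulrA [X in twist * X](comult_s_conj (B := star twist)).
    by rewrite mulrA twist_unitary // mul1r.
  move=> g /ub/b_centr[t ->]; rewrite star_twist // -scalerAr -scalerAl.
  by rewrite (v4_elt_conj _ (si := id)) // => s; rewrite !hM v4_addC.
have [x uE] := comult_s_group_like u0 uD.
have /b_centr[s xE] : (b ^ x = b)%g by apply: ub;
  rewrite uE ffunE eqxx oner_eq0.
by exists s; rewrite uE xE.
Qed.

(** On the nontrivial coset of the Klein group in its normaliser, conjugation
    exchanges [b] and [bc], which turns the twist into its adjoint. *)
Lemma group_like_off_v4 u : group_like u ->
  (forall x, u x != 0 -> b ^ x = b * c)%g -> rmat * Ds u = tensor u u.
Proof.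
move=> uG ub; rewrite -uG -mulrA [X in _ = twist * X](comult_s_conj (B :=
  twist)).
  by rewrite mulrA twist_sqr.
move=> g /ub gb; rewrite star_twist // -scalerAr -scalerAl.
rewrite (v4_elt_conj _ (si := fun s => (s.1, s.1 (+) s.2))).
- congr (_ *: (_ * _)); apply: eq_v4_elt => s t.
  by rewrite twist_coef_swap.
- by case=> [[] []].
have bg : (b * g = g * (b * c))%g by rewrite -gb conjgC.
have gb' : (g * b = b * c * g)%g.
  by rewrite -[in RHS]mulgA cZ mulgA bg -!mulgA cc mulg1.
case=> [[] []]; rewrite /v4 /= ?mulg1 ?mul1g ?expg1 //.
Qed.

Lemma off_v4_coef u s x : rmat * Ds u = tensor u u ->
  u x * u (h s * x)%g = 4^-1 * \sum_r v4_sign C r s * u (h r * x)%g.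
Proof. by move=> uD; rewrite -tensorE -uD rmat_comultE. Qed.

(** Summing, over the four translates [z] of a point [y], the formulas for
    [u y * u z] gives [u y] times the sum of the coefficients on the left and
    [u y] on the right. *)
Lemma off_v4_sum u s x : rmat * Ds u = tensor u u -> u (h s * x)%g != 0 ->
  \sum_r u (h r * x)%g = 1.
Proof.
move=> uD; rewrite (reindex_inj (v4_add_inj (s := s))) /=.
under eq_bigr => r _ do rewrite v4_addC -hM -mulgA.
move: (h s * x)%g => y uy; have E t := off_v4_coef t y uD.
have := E (false, false); have := E (false, true).
have := E (true, false); have := E (true, true).
rewrite !sum_v4 /v4_sign /v4 /= !(expg0, expg1, mul1g, mulg1, mul1r, mulN1r).
have aux (p q r t : C) : p != 0 ->
    p * t = 4^-1 * (p - q - r + t) -> p * r = 4^-1 * (p - q + r - t) ->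
    p * q = 4^-1 * (p + q - r - t) -> p * p = 4^-1 * (p + q + r + t) ->
    p + q + r + t = 1.
  by move=> p0 E1 E2 E3 E4; apply: (mulfI p0);
    rewrite !mulrDr E1 E2 E3 E4 mulr1; field.
exact: aux.
Qed.

Lemma group_like_v4 s : group_like (lambda C (h s)).
Proof.
rewrite /group_like comult_s_lambda star_twist // -mulrA -scalerAr.
rewrite (v4_elt_conj _ (si := id)) // => [|t]; last by rewrite !hM v4_addC.
by rewrite scalerAl -star_twist // mulrA twist_unitary // mul1r tensor_lambda.
Qed.

End GroupLike.

(** * The dihedral group *)

Section DihedralFacts.
Variables (G : finGroupType) (n : nat) (a b : G).
Hypotheses (n_ge3 : (3 <= n)%N) (Gab : dihedral_gens n a b).

Local Notation c := (a ^+ n)%g.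
Local Notation h := (v4 c b).

Lemma dihedral_bb : (b * b = 1)%g.
Proof. by case: Gab => _ _ _ + _; rewrite expg2. Qed.

Lemma dihedral_expn0 : (0 < 2 * n)%N.
Proof. by rewrite muln_gt0 (dihedral_n_gt0 Gab). Qed.

Lemma dihedral_order : #[a]%g = (2 * n)%N.
Proof.
have [_ _ a1 _ _] := Gab; apply/eqP; rewrite eqn_dvd order_dvdn a1 eqxx /=.
have N0 := dihedral_expn0; apply/eqP.
have E : (a ^+ (#[a]%g %% (2 * n)) * b ^+ false = a ^+ 0 * b ^+ false)%g.
  by rewrite expg_mod // expg_order.
by have [] := @dihedral_inj _ _ _ _ Gab (Ordinal (ltn_pmod _ N0)) (Ordinal N0)
  _ _ E.
Qed.

Lemma dihedral_bX k : (b * a ^+ k = (a ^+ k)^-1 * b)%g.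
Proof.
have [_ _ _ _ ba] := Gab; elim: k => [|k IHk];
  first by rewrite invg1 mulg1 mul1g.
by rewrite {1}expgSr mulgA IHk -mulgA ba mulgA expgS invMg.
Qed.

Lemma dihedral_cc : (c * c = 1)%g.
Proof. by rewrite -expgD addnn -mul2n -dihedral_order expg_order. Qed.

Lemma dihedral_cV : (c^-1 = c)%g.
Proof. by apply: (mulgI c); rewrite mulgV dihedral_cc. Qed.

Lemma dihedral_cZ x : (c * x = x * c)%g.
Proof.
have [i [j ->]] := dihedral_surj Gab x;
  rewrite mulgA -expgD addnC expgD -!mulgA.
congr (_ * _)%g; case: j; rewrite ?mulg1 ?mul1g ?expg1 //.
by rewrite dihedral_bX dihedral_cV.
Qed.

Lemma dihedral_a2 : (a ^+ 2 != 1)%g.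
Proof.
rewrite -order_dvdn dihedral_order gtnNdvd //.
exact: leq_trans (leq_mul (leqnn 2) n_ge3).
Qed.

Lemma dihedral_a4 : (a ^+ 4 != 1)%g.
Proof.
rewrite -order_dvdn dihedral_order gtnNdvd //.
exact: leq_trans (leq_mul (leqnn 2) n_ge3).
Qed.

Lemma dihedral_a2c : (a ^+ 2 != c)%g.
Proof.
rewrite eq_expg_mod_order dihedral_order !modn_small.
- by rewrite neq_ltn n_ge3.
- by rewrite -{1}[n]mul1n ltn_pmul2r // (leq_trans _ n_ge3).
exact: leq_trans (leq_mul (leqnn 2) n_ge3).
Qed.

Lemma dihedral_c1 : (c != 1)%g.
Proof.
rewrite -order_dvdn dihedral_order gtnNdvd ?(dihedral_n_gt0 Gab) //.
by rewrite -{1}[n]mul1n ltn_pmul2r // (dihedral_n_gt0 Gab).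
Qed.

Lemma dihedral_b_notin i : (b != a ^+ i)%g.
Proof.
apply/eqP=> bE; have [_ _ a1 _ _] := Gab; have N0 := dihedral_expn0.
have E : (a ^+ 0 * b ^+ true = a ^+ (i %% (2 * n)) * b ^+ false)%g.
  by rewrite expg_mod // mul1g mulg1 expg1.
by have [] := @dihedral_inj _ _ _ _ Gab (Ordinal N0) (Ordinal (ltn_pmod i N0))
  _ _ E.
Qed.

Lemma dihedral_conj_b i (j : bool) :
  (b ^ (a ^+ i * b ^+ j) = (b * a ^+ (2 * i)) ^ (b ^+ j))%g.
Proof.
rewrite conjgM; congr (_ ^ _)%g;
  rewrite conjgE mulgA -dihedral_bX -mulgA -expgD.
by rewrite addnn mul2n.
Qed.

Lemma dihedral_conj_b_eq i (j e : bool) :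
  (b ^ (a ^+ i * b ^+ j) = b * c ^+ e -> a ^+ (2 * i) = c ^+ e)%g.
Proof.
rewrite dihedral_conj_b => E; apply: (mulgI b); apply: (conjg_inj (b ^+ j)%g).
have bcb : commute (b * c ^+ e)%g (b ^+ j)%g.
  apply: commuteX; apply: commute_sym; apply: commuteM => //.
  by apply: commuteX; apply: commute_sym; apply: dihedral_cZ.
by rewrite E [RHS]conjgE bcb mulKg.
Qed.

Lemma dihedral_b_centraliser x : (b ^ x = b)%g -> exists s, x = h s.
Proof.
have [i [j ->]] := dihedral_surj Gab x => E.
have /eqP := @dihedral_conj_b_eq i j false (etrans E (esym (mulg1 b))).
rewrite -order_dvdn dihedral_order dvdn_pmul2l // => ni.
exists (j, i == n :> nat); rewrite /v4 /=.
have cX : (a ^+ i = c ^+ (i == n :> nat))%g.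
  case: eqP => [->|/eqP iN]; first by rewrite expg1.
  case/dvdnP: ni (ltn_ord i) iN => [[|[|k]] ->]; rewrite ?mul1n ?eqxx //.
  by rewrite ltn_pmul2r ?(dihedral_n_gt0 Gab).
by rewrite cX; apply: (commuteX2 (i == n :> nat) j (dihedral_cZ b)).
Qed.

End DihedralFacts.

(** * Automorphisms and group-like elements *)

Section Automorphisms.
Variables (C : numClosedFieldType) (G : finGroupType) (n : nat) (a b : G).
Hypotheses (n_ge3 : (3 <= n)%N) (Gab : dihedral_gens n a b).

Local Notation c := (a ^+ n)%g.
Local Notation h := (v4 c b).
Local Notation K := (KD C n a b).
Local Notation L := (lambda C).
Local Notation twist := (twist C c b).
Local Notation rmat := (rmat C c b).
Local Notation group_like := (group_like c b).
Local Notation Ds := (comult_s C G).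
Implicit Types (phi : 'End(galg C G)) (u : galg C G).

Let cc := dihedral_cc Gab.
Let bb := dihedral_bb Gab.
Let cZ := dihedral_cZ Gab.
Let cV := dihedral_cV Gab.
Let bX := dihedral_bX Gab.
Let bV : (b^-1 = b)%g. Proof. by apply: (mulgI b); rewrite mulgV bb. Qed.
Let c1 : c != 1%g := dihedral_c1 Gab.
Let b1 : b != 1%g := dihedral_b_notin Gab 0.
Let bc : b != c := dihedral_b_notin Gab n.
Let ba : (b * a = a^-1 * b)%g. Proof. by case: Gab. Qed.
Let baV : (b * a^-1 = a * b)%g.
Proof. by apply: (mulgI a^-1)%g;
  rewrite mulgA -ba -mulgA mulgV mulg1 mulKg. Qed.
Let bZ := dihedral_b_centraliser Gab.

Definition v4_index (s : bool * bool) : 'I_4 :=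
  if s.1 then if s.2 then Ordinal (isT : (3 < 4)%N) else Ordinal (isT : (2 <
    4)%N)
  else if s.2 then Ordinal (isT : (1 < 4)%N) else Ordinal (isT : (0 < 4)%N).

Lemma kd_h_index s : kd_h n a b (v4_index s) = h s.
Proof.
by case: s => [[] []]; rewrite /kd_h /v4 /= ?mulg1 ?mul1g ?expg1.
Qed.

Lemma kd_c_index s t : kd_c C (v4_index s) (v4_index t) = 8^-1 * twist_coef C s
  t.
Proof. by case: s t => [[] []] [[] []]. Qed.

Lemma kd_OmegaE : kd_Omega C n a b = twist.
Proof.
have idx_bij : {on predT, bijective v4_index}.
  exists (fun i : 'I_4 => ((1 < i)%N, odd i)) => [[[] []] //|i _].
  by apply/val_inj; case: i => [[|[|[|[|]]]]].
rewrite /kd_Omega /twist /v4_elt scaler_sumr (reindex _ idx_bij) /=.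
apply: eq_bigr => s _; rewrite scaler_sumr (reindex _ idx_bij) /=.
by apply: eq_bigr => t _; rewrite kd_c_index !kd_h_index tensor_lambda scalerA.
Qed.

Lemma comult_KDE u : comult K u = twist * Ds u * star twist.
Proof. by rewrite KD_comultE kd_OmegaE. Qed.

Lemma kac_aut_group_like phi u :
  kac_aut K phi -> group_like u -> group_like (phi u).
Proof.
move=> [_ _ _ /lfunP/(_ u)];
  rewrite [LHS]comp_lfunE [RHS]comp_lfunE !comult_KDE.
by move=> phiD; rewrite /group_like => uG; rewrite phiD uG tensor_mapE.
Qed.

Lemma lambda_c_commute u : L c * u = u * L c.
Proof. by apply/ffunP=> x; rewrite lambda_mulE mul_lambdaE cV cZ. Qed.

Lemma lambda_c : L c = L (h (false, true)).
Proof. by rewrite /v4 /= mul1g expg1. Qed.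

Lemma lambda_b : L b = L (h (true, false)).
Proof. by rewrite /v4 /= mulg1 expg1. Qed.

Lemma galg_commute u : u * L a = L a * u -> u * L b = L b * u ->
  forall v, u * v = v * u.
Proof.
move=> ua ub v; rewrite (galg_basis v) mulr_suml mulr_sumr.
apply: eq_bigr => g _; rewrite -scalerAl -scalerAr; congr (_ *: _).
have [i [j ->]] := dihedral_surj Gab g; rewrite lambdaM !lambdaX.
by apply: commrM; apply: commrX.
Qed.

Lemma tensor_map_v4_elt phi (si : bool * bool -> bool * bool) f :
  involutive si -> (forall s, phi (L (h s)) = L (h (si s))) ->
  tensor_map phi (v4_elt c b f) = v4_elt c b (fun s t => f (si s) (si t)).
Proof.
move=> siK phih; rewrite linear_sum [RHS](reindex_inj (inv_inj siK)).
apply: eq_bigr => s _; rewrite linear_sum [RHS](reindex_inj (inv_inj siK)).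
apply: eq_bigr => t _.
by rewrite linearZ /= -tensor_lambda tensor_mapE !phih tensor_lambda !siK.
Qed.

Section OneAutomorphism.
Variable phi : 'End(galg C G).
Hypothesis phiP : kac_aut K phi.

Let phiM u v : phi (u * v) = phi u * phi v.
Proof. by case: phiP => /ahom_inP[pM _] _ _ _; rewrite pM ?memvf. Qed.

Let phi1 : phi 1 = 1. Proof. by case: phiP => /ahom_inP[]. Qed.

Let phi_inj : injective phi. Proof. by case: phiP => _ /lker0P. Qed.

Let phi_surj u : exists v, u = phi v.
Proof.
case: phiP => _ phi0 _ _.
by exists ((phi^-1)%VF u); rewrite lker0_lfunVK.
Qed.

Let phi_lambda_neq0 g : phi (L g) != 0.
Proof.
apply/eqP=> E; case/eqP: (lambda_neq0 C g); apply: phi_inj.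
by rewrite E linear0.
Qed.

Let c_phi g : L c * phi (L g) != phi (L g).
Proof.
apply/eqP=> /(congr1 (fun u => u * phi (L g^-1))).
rewrite -mulrA -!phiM -!lambdaM mulgV lambda1 phi1 mulr1 -lambda1.
by move/lambda_inj/eqP; rewrite (negPf c1).
Qed.

(** The image of [c] is a central group-like element.  In the Klein group,
    [c] is the only central element besides 1.  On the other coset, conjugation
    by [a] moves the elements outside the rotation group out of the coset, so
    the coefficients there vanish; the remaining two are then equal and the
    image would be fixed by [c]. *)
Lemma kac_aut_c : phi (L c) = L c.
Proof.
set u := phi _; have uG : group_like u.
  apply: kac_aut_group_like => //.
  by rewrite lambda_c; apply: group_like_v4.
have uZ v : u * v = v * u.
  by have [w ->] := phi_surj v; rewrite /u -!phiM lambda_c_commute.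
have uJ y : u (a * y * a^-1)%g = u y.
  have /ffunP/(_ (a * y)%g) := uZ (L a); rewrite lambda_mulE mul_lambdaE => ->.
  by rewrite mulKg.
have [ub|ubc] := group_like_coset cc bb cZ c1 b1 bc uG (c_phi c).
  have [[s1 s2] uE] := group_like_in_v4 cc bb cZ bZ uG (phi_lambda_neq0 c) ub.
  have /lambda_inj : L (h (s1, s2) * a)%g = L (a * h (s1, s2))%g.
    by rewrite [LHS]lambdaM [RHS]lambdaM -uE uZ.
  case: s1 uE => uE.
    have ca : (c ^+ s2 * a = a * c ^+ s2)%g by apply: (commuteX2 s2 1 (cZ a)).
    rewrite /v4 /= expg1 -mulgA ca !mulgA => /mulIg; rewrite ba => /mulIg aV.
    by case/eqP: (dihedral_a2 n_ge3 Gab); rewrite expg2 -{1}aV mulVg.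
  move=> _; case: s2 uE => uE; first by rewrite uE /v4 /= mul1g expg1.
  have /phi_inj/lambda_inj/eqP : phi (L c) = phi (L 1%g).
    by rewrite -/u uE /v4 /= mulg1 lambda1 phi1.
  by rewrite (negPf c1).
have uD := group_like_off_v4 cc bb cZ uG ubc.
have ua i : u (a ^+ i * b)%g = 0.
  apply/eqP/idPn => ui; have e1 := ubc _ ui.
  have e2 : u (a ^+ (i + 2) * b)%g != 0.
    rewrite addnC expgD -[X in u X](_ : a * (a ^+ i * b) * a^-1 = _)%g ?uJ //.
    rewrite -!mulgA; congr (_ * _)%g; rewrite [RHS]mulgA -expgS expgSr -mulgA;
      congr (_ * _)%g.
    by rewrite -[in RHS]baV.
  have e3 := dihedral_conj_b_eq Gab (j := true) (e := true) e1.
  have := dihedral_conj_b_eq Gab (j := true) (e := true) (ubc _ e2).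
  rewrite mulnDr expgD e3 => /(canRL (mulKg _)); rewrite mulVg => /eqP.
  by rewrite (negPf (dihedral_a4 n_ge3 Gab)).
have ub i : u (b * a ^+ i)%g = 0 by rewrite (dihedral_bX Gab) invg_expg -expgM
  ua.
case/eqP: (c_phi c); rewrite -/u; apply/ffunP=> x.
rewrite lambda_mulE cV.
have eqc y : u y != 0 -> u (c * y)%g = u y.
  have [i [j ->]] := dihedral_surj Gab y; case: j => [|ui];
    first by rewrite expg1 ua eqxx.
  have := off_v4_coef cc bb cZ c1 b1 bc (true, false) (a ^+ i)%g uD.
  rewrite sum_v4 /v4_sign /v4 /= !(expg0, expg1, mulg1, mul1g) -[(b * _ *
    _)%g]mulgA -expgD !ub.
  rewrite !mulr0 !addr0 expr0 expr1 mul1r mulN1r => /esym/eqP.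
  by rewrite mulf_eq0 invr_eq0 pnatr_eq0 subr_eq0 => /eqP.
have [ux|ux] := eqVneq (u x) 0; last exact: eqc.
have [ucx|ucx] := eqVneq (u (c * x)%g) 0; first by rewrite ux ucx.
by rewrite -(eqc _ ucx) mulgA cc mul1g.
Qed.
Let off_v4_decomposition u x :
  (forall y, u y != 0 -> b ^ y = b * c)%g -> (b ^ x = b * c)%g ->
  u = \sum_s u (h s * x)%g *: L (h s * x)%g.
Proof.
move=> ubc xbc; apply/ffunP=> y; rewrite sum_ffunE.
have [[s yE]|noty] := pselect (exists s, y = h s * x)%g.
  rewrite (bigD1 s) //= big1 ?addr0 => [|t ts]; rewrite !ffunE yE.
    by rewrite eqxx /GRing.scale /= mulr1.
  by rewrite (inj_eq (mulIg x)) (inj_eq (v4_inj cc bb (cZ b) c1 b1 bc)) eq_sym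
    (negPf ts) scaler0.
rewrite big1 => [|s _]; last first.
  rewrite !ffunE; case: eqP => [yE|_]; last by rewrite scaler0.
  by case: noty; exists s.
apply/eqP/idPn => /ubc ybc; apply: noty.
have [|s sE] := bZ (x := (y * x^-1)%g); first by rewrite conjgM ybc -xbc conjgK.
by exists s; rewrite -sE mulgKV.
Qed.

(** The image [u] of [b] is an involutive group-like element different from 1
    and [c], so it only has to be kept out of the nontrivial coset of the Klein
    group.  There the condition [u * u = 1] would give [u (1 + c) = x (1 + c)]
    for a power [x] of [a] with square [c].  This element is central,
    whereas [b (1 + c)] does not commute with [a] as soon as [2 < n]. *)
Lemma kac_aut_b : exists e : bool, phi (L b) = L (b * c ^+ e)%g.
Proof.
have [u uE] : exists u, u = phi (L b) by exists (phi (L b)).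
have uG : group_like u.
  by rewrite uE; apply: kac_aut_group_like => //; rewrite lambda_b;
    apply: group_like_v4.
have uu : u * u = 1 by rewrite uE -phiM -lambdaM bb lambda1 phi1.
have cu : L c * u != u by rewrite uE c_phi.
have u0 : u != 0 by rewrite uE.
have [ub|ubc] := group_like_coset cc bb cZ c1 b1 bc uG cu.
  have [[s1 s2]] := group_like_in_v4 cc bb cZ bZ uG u0 ub.
  rewrite uE; case: s1 => [|E]; first by exists s2.
  have : L b = L (h (false, s2)).
    apply: phi_inj; rewrite E; case: s2 {E};
      first by rewrite -lambda_c kac_aut_c.
    by rewrite /v4 /= mulg1 lambda1 phi1.
  by move/lambda_inj/eqP;
    rewrite /v4 /= mul1g -expgM (negPf (dihedral_b_notin Gab _)).
exfalso; have uD := group_like_off_v4 cc bb cZ uG ubc.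
have [y uy] : exists y, u y != 0.
  apply/existsP; rewrite -negb_forall; apply: contraNN u0 => /forallP u0.
  by apply/eqP/ffunP=> y; rewrite ffunE; apply/eqP.
have [i [j yE]] := dihedral_surj Gab y; pose x := (a ^+ i)%g.
have x2 : (x * x = c)%g.
  have := ubc _ uy; rewrite yE => /(dihedral_conj_b_eq Gab (e := true)).
  by rewrite -expgD addnn mul2n.
have xV : (x^-1 = c * x)%g by apply: (mulIg x); rewrite mulVg -mulgA x2 cc.
have bx : (b * x = c * x * b)%g by rewrite /x bX -/x xV.
have xbc : (b ^ x = b * c)%g by rewrite conjgE bx cZ -mulgA mulKg cZ.
have uDec := off_v4_decomposition ubc xbc.
have [s us] : exists s, u (h s * x)%g != 0.
  apply/existsP; rewrite -negb_forall; apply: contraNN u0 => /forallP us0.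
  by rewrite uDec big1 // => s _; rewrite (eqP (us0 s)) scale0r.
have uS := off_v4_sum cc bb cZ c1 b1 bc uD us.
have usq t : u (h t * x)%g * u (h t * x)%g = 4^-1.
  have := off_v4_coef cc bb cZ c1 b1 bc (false, false) (h t * x)%g uD.
  rewrite {2}/v4 /= expg0 mulg1 mul1g => ->; rewrite -[RHS]mulr1 -uS;
    congr (_ * _).
  rewrite [RHS](reindex_inj (v4_add_inj (s := t))); apply: eq_bigr => r _.
  rewrite [in RHS]v4_addC -[in RHS](v4M cc bb (cZ b)) -[in RHS]mulgA.
  by rewrite /v4_sign !andbF mul1r.
have u1 : \sum_s u (h s * x)%g * u (h s * x)^-1%g = 1.
  have /ffunP/(_ 1%g) := uu;
    rewrite {1}uDec mulr_suml sum_ffunE ffunE eqxx => u1; apply: etrans u1.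
  by apply: eq_bigr => t _; rewrite -scalerAl ffunE lambda_mulE mulg1.
have := off_v4_coef cc bb cZ c1 b1 bc (false, true) x uD.
have := usq (true, false); have := usq (true, true).
move: u1 uS; rewrite !sum_v4 /v4_sign /v4 /= !(expg0, expg1, mul1g, mulg1).
have -> : (x^-1 = c * x)%g by [].
have -> : ((c * x)^-1 = x)%g by rewrite -xV invgK.
have -> : ((b * x)^-1 = b * x)%g by rewrite invMg xV bV bx.
have bcx : (b * c * x = x * b)%g by rewrite -cZ -mulgA bx !mulgA cc mul1g.
have -> : ((b * c * x)^-1 = b * c * x)%g by rewrite {1}bcx invMg xV bV mulgA.
have aux (p q r t : C) : p * q + q * p + r * r + t * t = 1 ->
    p + q + r + t = 1 -> t * t = 4^-1 -> r * r = 4^-1 ->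
    p * q = 4^-1 * (1 * p + 1 * q + -1 * r + -1 * t) -> p + q = 1 /\ r + t = 0.
  rewrite !mul1r !mulN1r => E1 E2 E3 E4 E5.
  have pq : p * q = 4^-1.
    have E : 2 * (p * q) = p * q + q * p + r * r + t * t - 4^-1 - 4^-1.
      by rewrite E3 E4; ring.
    apply: (mulfI (x := 2)); first by rewrite pnatr_eq0.
    by rewrite E E1; field.
  have E6 : p + q - r - t = 1.
    apply: (mulfI (x := 4^-1)); first by rewrite invr_eq0 pnatr_eq0.
    by rewrite -E5 pq mulr1.
  have two : 2 != 0 :> C by rewrite pnatr_eq0.
  split; apply: (mulfI two).
    transitivity ((p + q + r + t) + (p + q - r - t)); first by ring.
    by rewrite E2 E6; ring.
  transitivity ((p + q + r + t) - (p + q - r - t)); first by ring.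
  by rewrite E2 E6; ring.
move=> E1 E2 E3 E4 E5; have [] := aux _ _ _ _ E1 E2 E3 E4 E5.
move=> {aux E1 E2 E3 E4 E5} E1 E2.
have ucE : u + L c * u = L x + L (c * x)%g.
  have lc g : L c * L g = L (c * g)%g by rewrite lambdaM.
  rewrite {1 2}uDec !sum_v4 !mulrDr -!scalerAr !lc /v4 /= !(expg0, expg1,
    mulg1, mul1g).
  have -> : (c * (c * x) = x)%g by rewrite mulgA cc mul1g.
  have -> : (c * (b * x) = b * c * x)%g by rewrite mulgA cZ.
  have -> : (c * (b * c * x) = b * x)%g by rewrite !mulgA (cZ b) -(mulgA b c c)
    cc mulg1.
  rewrite (AC (4 * 4) ((1 * 6) * (5 * 2) * ((3 * 8) * (7 * 4)))) /=.
  by rewrite -!scalerDl E1 E2 !scale1r !scale0r !addr0.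
pose z := L b + L (c * b)%g.
have phiz : phi z = L x + L (c * x)%g.
  by rewrite -ucE uE /z linearD /= lambdaM phiM kac_aut_c.
have zZ : z * L a = L a * z.
  apply: phi_inj; rewrite !phiM; apply: galg_commute; rewrite phiz.
    have xa : (x * a = a * x)%g by rewrite /x -expgSr expgS.
    by rewrite mulrDl mulrDr -!lambdaM -(mulgA c) xa !mulgA (cZ a).
  by rewrite mulrDl mulrDr -!lambdaM mulgA bcx bx addrC.
have /ffunP/(_ (a * b)%g) := zZ; rewrite lambda_mulE mul_lambdaE !ffunE.
have eqb g : (g * b == b)%g = (g == 1)%g by rewrite -{2}(mul1g b) (inj_eq
  (mulIg b)).
rewrite mulKg -mulgA baV mulgA -expg2 (inj_eq (mulIg b)) eqxx [b == _]eq_sym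
  !eqb.
rewrite (negPf (dihedral_a2 n_ge3 Gab)) (negPf (dihedral_a2c n_ge3 Gab)) (negPf
  c1).
by rewrite !addr0 => /eqP; rewrite eq_sym oner_eq0.
Qed.

End OneAutomorphism.

(** An automorphism fixing the Klein group fixes the twist, so it
    is an automorphism of the untwisted group algebra, i.e. of the group. *)
Lemma kac_aut_fix_v4 phi : kac_aut K phi -> phi (L b) = L b ->
  exists2 k, coprime k (2 * n) & phi = Theta C n a b k.
Proof.
move=> phiP phib; have phic := kac_aut_c phiP.
have [phiA /lker0P phi_inj _ /lfunP/(_ (L a))] := phiP.
have /ahom_inP[phiM phi1] := phiA.
rewrite [LHS]comp_lfunE [RHS]comp_lfunE !comult_KDE.
have /ahom_inP[TM _] := tensor_map_ahom phiA; rewrite !TM ?memvf //.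
have phiX g k : phi (L (g ^+ k)%g) = phi (L g) ^+ k.
  by rewrite lambdaX; elim: k => [|k IHk];
    rewrite ?phi1 // !exprS phiM ?memvf // IHk.
have phih s : phi (L (h s)) = L (h s).
  by rewrite /v4 lambdaM phiM ?memvf // (phiX b) (phiX c) phib phic -!lambdaX.
have Tv4 f : tensor_map phi (v4_elt c b f) = v4_elt c b f.
  exact: (tensor_map_v4_elt (si := id)).
rewrite star_twist // !linearZ /= !Tv4 -star_twist // comult_s_lambda
  -tensor_lambda.
rewrite tensor_mapE => /(congr1 (fun w => star twist * w * twist)).
rewrite !mulrA star_twist_unitary // !mul1r -!mulrA star_twist_unitary //
  !mulr1.
move=> phiD; have [g phia] : exists g, phi (L a) = L g.
  apply: comult_s_group_like phiD; apply/eqP => phia0.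
  by case/eqP: (lambda_neq0 C a); apply: phi_inj; rewrite phia0 linear0.
have gX m : (g ^+ m = 1 -> a ^+ m = 1)%g.
  move=> gm; apply: (@lambda_inj C); apply: phi_inj.
  by rewrite phiX phia -lambdaX gm lambda1 phi1.
have [k [j gE]] := dihedral_surj Gab g.
case: j gE => gE.
  case/eqP: (dihedral_a2 n_ge3 Gab); apply: gX.
  by rewrite gE expg2 expg1 -mulgA (mulgA b) bX -mulgA bb mulg1 mulgV.
rewrite mulg1 in gE; exists k.
  have N0 := dihedral_expn0 Gab.
  have dvd : (2 * n %| (2 * n) %/ gcdn (2 * n) k)%N.
    have /eqP := gX _ (expg_order g).
    by rewrite gE orderXgcd -order_dvdn (dihedral_order Gab).
  have d0 : (0 < gcdn (2 * n) k)%N by rewrite gcdn_gt0 N0.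
  rewrite coprime_sym /coprime eqn_leq d0 andbT leqNgt; apply/negP=> d1.
  have := dvdn_leq _ dvd;
    rewrite divn_gt0 // dvdn_leq ?dvdn_gcdl // => /(_ isT).
  by rewrite leqNgt ltn_Pdiv.
have [ThA Tha Thb] := ThetaP C Gab k.
apply: (ahom_gen_inj (s := [:: a; b])) => // [|x].
  by case: Gab => <- _ _ _ _; congr <<_>>%g; apply/setP=> x; rewrite !inE.
rewrite !inE => /orP[] /eqP->; last by rewrite phib Thb.
by rewrite phia gE Tha.
Qed.

End Automorphisms.
(** * Theta_k and Theta' are automorphisms *)

Section Converse.
Variables (C : numClosedFieldType) (G : finGroupType) (n : nat) (a b : G).
Hypothesis Gab : dihedral_gens n a b.

Local Notation c := (a ^+ n)%g.
Local Notation h := (v4 c b).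
Local Notation K := (KD C n a b).
Local Notation L := (lambda C).
Local Notation twist := (twist C c b).
Local Notation rmat := (rmat C c b).
Local Notation Ds := (comult_s C G).
Local Notation Th := (Theta C n a b).
Local Notation Th' := (Theta' C n a b).
Implicit Types (phi : 'End(galg C G)) (u v : galg C G) (s t : bool * bool).

Let cc := dihedral_cc Gab.
Let bb := dihedral_bb Gab.
Let cZ := dihedral_cZ Gab.
Let cV := dihedral_cV Gab.

Lemma dihedral_generated : <<[set g in [:: a; b]]>>%g = [set: G].
Proof. by case: Gab => <- _ _ _ _; congr <<_>>%g; apply/setP=> x;
  rewrite !inE. Qed.

Lemma mem_generators g : g \in [:: a; b] -> g = a \/ g = b.
Proof. by rewrite !inE => /orP[] /eqP; [left|right]. Qed.

Lemma ahomX phi u k : ahom_in fullv phi -> phi (u ^+ k) = phi u ^+ k.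
Proof.
move=> /ahom_inP[phiM phi1]; elim: k => [|k IHk]; first by rewrite !expr0 phi1.
by rewrite !exprS phiM ?memvf // IHk.
Qed.

Lemma starX u k : star (u ^+ k) = star u ^+ k.
Proof.
elim: k => [|k IHk]; first by rewrite !expr0 -lambda1 star_lambda invg1.
by rewrite exprSr exprS starM IHk.
Qed.

Lemma ahom_star phi : ahom_in fullv phi ->
    (forall g, g \in [:: a; b] -> phi (star (L g)) = star (phi (L g))) ->
  forall u, phi (star u) = star (phi u).
Proof.
move=> phiA phiS u; have /ahom_inP[phiM _] := phiA.
rewrite {1 2}(galg_basis u) star_sum !linear_sum star_sum;
  apply: eq_bigr => g _.
rewrite starZ !linearZ starZ /=; congr (_ *: _).
have [i [j ->]] := dihedral_surj Gab g; rewrite lambdaM !lambdaX starM.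
rewrite !starX !phiM ?memvf // !ahomX // starM !starX.
by rewrite !phiS // !inE eqxx ?orbT.
Qed.

Lemma comult_KD_ahom : ahom_in fullv (comult K).
Proof.
have /ahom_inP[DsM Ds1] := comult_s_ahom C G.
apply/ahom_inP; split=> [u v _ _|];
  rewrite !comult_KDE ?Ds1 ?mulr1 ?twist_unitary //.
rewrite DsM ?memvf // !mulrA -[X in _ = X * _ * _]mulrA star_twist_unitary //.
by rewrite mulr1.
Qed.

Lemma kac_aut_generators phi : ahom_in fullv phi -> injective phi ->
    (forall g, g \in [:: a; b] -> phi (star (L g)) = star (phi (L g))) ->
    (forall g, g \in [:: a; b] ->
       comult K (phi (L g)) = tensor_map phi (comult K (L g))) ->
  kac_aut K phi.
Proof.
move=> phiA /lker0P phi0 phiS phiD; split=> //; first exact: ahom_star.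
apply: (ahom_gen_inj dihedral_generated).
- exact: (comp_is_ahom comult_KD_ahom phiA).
- exact: (comp_is_ahom (tensor_map_ahom phiA) comult_KD_ahom).
by move=> g gab; rewrite [LHS]comp_lfunE [RHS]comp_lfunE phiD.
Qed.

Lemma ahom_lambdaV phi g g' :
  ahom_in fullv phi -> phi (L g) = L g' -> phi (L g^-1%g) = L g'^-1%g.
Proof.
move=> /ahom_inP[phiM phi1] gg'.
rewrite -[LHS]mul1r -lambda1 -(mulVg g') lambdaM -gg' -mulrA -phiM ?memvf //.
by rewrite -lambdaM mulgV lambda1 phi1 mulr1.
Qed.

Lemma Theta_lambda_c k : coprime k (2 * n) -> Th k (L c) = L c.
Proof.
move=> ck; have [ThA Tha _] := ThetaP C Gab k.
have kodd : odd k by move: ck; rewrite coprimeMr coprimen2 => /andP[].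
rewrite {1}lambdaX ahomX // Tha -lambdaX -expgM mulnC expgM.
rewrite -(odd_double_half k).
by rewrite kodd expgD -mul2n expgM (expg2 c) cc expg1n mulg1.
Qed.

Lemma Theta_comp k l : (Th k \o Th l)%VF = Th (k * l).
Proof.
have [kA ka kb] := ThetaP C Gab k; have [lA la lb] := ThetaP C Gab l.
have [klA kla klb] := ThetaP C Gab (k * l).
move: (Th k) (Th l) (Th (k * l)) kA ka kb lA la lb klA kla klb => phi psi chi.
move=> kA ka kb lA la lb klA kla klb.
apply: (ahom_gen_inj dihedral_generated) => //; first exact: comp_is_ahom.
move=> g /mem_generators[] ->; rewrite comp_lfunE; last by rewrite lb kb klb.
by rewrite la lambdaX ahomX // ka -lambdaX -expgM kla.
Qed.

Lemma Theta_mod k l : k = l %[mod 2 * n] -> Th k = Th l.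
Proof.
by move=> kl; rewrite /Theta -(expg_mod_order a k) -(expg_mod_order a l)
  (dihedral_order Gab) kl.
Qed.

Lemma Theta1 : Th 1 = \1%VF.
Proof.
have [ThA Tha Thb] := ThetaP C Gab 1.
apply: (ahom_gen_inj dihedral_generated) => //; first exact: id_is_ahom.
by move=> g /mem_generators[] ->; rewrite id_lfunE.
Qed.

Lemma Theta_kac_aut k : coprime k (2 * n) -> kac_aut K (Th k).
Proof.
move=> ck; have [ThA Tha Thb] := ThetaP C Gab k.
have Thc := Theta_lambda_c ck; have /ahom_inP[ThM _] := ThA.
have Thh s : Th k (L (h s)) = L (h s).
  by rewrite /v4 lambdaM ThM ?memvf // !(lambdaX _ b) !(lambdaX _ c) !ahomX //
    Thb Thc.
have /ahom_inP[TM _] := tensor_map_ahom ThA.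
have Ttw : tensor_map (Th k) twist = twist.
  by rewrite linearZ /= (tensor_map_v4_elt (si := id)).
have Ttws : tensor_map (Th k) (star twist) = star twist.
  by rewrite star_twist // linearZ /= (tensor_map_v4_elt (si := id)).
have [k' kk'] : exists k', (k' * k = 1 %[mod 2 * n])%N.
  exists (k ^ (totient (2 * n)).-1)%N;
    rewrite -expnSr prednK ?Euler_exp_totient //.
  by rewrite totient_gt0 (dihedral_expn0 Gab).
have ThK : cancel (Th k) (Th k').
  by move=> u; rewrite -[LHS]comp_lfunE Theta_comp (Theta_mod kk') Theta1
    id_lfunE.
apply: (kac_aut_generators ThA (can_inj ThK)).
- move=> g /mem_generators[] ->; rewrite ?Tha ?Thb !star_lambda;
  exact: ahom_lambdaV.
move=> g gab; have [g' gE] : exists g', Th k (L g) = L g'.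
  by case: (mem_generators gab) => ->; [exists (a ^+ k)%g|exists b].
by rewrite !comult_KDE !TM ?memvf // Ttw Ttws gE !comult_s_lambda
  -!tensor_lambda tensor_mapE gE.
Qed.

Let two0 : (2 : C) != 0. Proof. by rewrite pnatr_eq0. Qed.

Definition v4_vec (f : bool * bool -> C) : galg C G := \sum_s f s *: L (h s).

Lemma tensor_v4_vec f g :
  tensor (v4_vec f) (v4_vec g) = v4_elt c b (fun s t => f s * g t).
Proof.
apply/ffunP=> -[x y]; rewrite tensorE !sum_ffunE big_distrl;
  apply: eq_bigr => s _.
rewrite sum_ffunE big_distrr; apply: eq_bigr => t _.
by rewrite !ffunE xpair_eqE -mulnb natrM /GRing.scale /= mulrACA.
Qed.

(** The central idempotents attached to the central involution [c]; Theta'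
    inverts [a] on the first summand and fixes it on the second. *)
Definition proj_plus : galg C G := 2^-1 *: (1 + L c).
Definition proj_minus : galg C G := 2^-1 *: (1 - L c).
Local Notation p := proj_plus.
Local Notation q := proj_minus.

Let Lcc : L c * L c = 1. Proof. by rewrite -lambdaM cc lambda1. Qed.
Let LcZ u : L c * u = u * L c. Proof. exact: (lambda_c_commute Gab). Qed.

Lemma proj_plusZ u : p * u = u * p.
Proof. by rewrite /proj_plus -scalerAl -scalerAr mulrDl mulrDr mul1r mulr1 LcZ.
  Qed.
Lemma proj_minusZ u : q * u = u * q.
Proof. by rewrite /proj_minus -scalerAl -scalerAr mulrBl mulrBr mul1r mulr1
  LcZ. Qed.

Lemma projD : p + q = 1.
Proof.
rewrite /proj_plus /proj_minus -scalerDr addrACA subrr addr0 -mulr2n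
  -scaler_nat scalerA (mulVf two0).
by rewrite scale1r.
Qed.

Lemma proj_plusK : p * p = p.
Proof.
rewrite /proj_plus -scalerAl -scalerAr mulrDl !mulrDr !mul1r !mulr1 Lcc [L c +
  1]addrC.
by rewrite -mulr2n -scaler_nat [in X in _ *: X]scalerA (mulVf two0) scale1r.
Qed.

Lemma proj_plus_minus : p * q = 0.
Proof. by rewrite -[q](addKr p) projD mulrDr mulr1 mulrN proj_plusK addNr. Qed.
Lemma proj_minus_plus : q * p = 0.
Proof. by rewrite proj_minusZ proj_plus_minus. Qed.
Lemma proj_minusK : q * q = q.
Proof. by rewrite -{1}[q](addKr p) projD mulrDl mul1r mulNr proj_plus_minus
  oppr0 add0r. Qed.

Let ppu u : p * (u * p) = u * p. Proof. by rewrite mulrA proj_plusZ -mulrA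
  proj_plusK. Qed.
Let pqu u : p * (u * q) = 0. Proof. by rewrite mulrA proj_plusZ -mulrA
  proj_plus_minus mulr0. Qed.
Let qpu u : q * (u * p) = 0. Proof. by rewrite mulrA proj_minusZ -mulrA
  proj_minus_plus mulr0. Qed.
Let qqu u : q * (u * q) = u * q. Proof. by rewrite mulrA proj_minusZ -mulrA
  proj_minusK. Qed.

Let vec_p s : C := if s.1 then 0 else 2^-1.
Let vec_q s : C := if s.1 then 0 else if s.2 then - 2^-1 else 2^-1.
Let vec_bp s : C := if s.1 then 2^-1 else 0.
Let vec_bq s : C := if s.1 then if s.2 then - 2^-1 else 2^-1 else 0.

Let pE : p = v4_vec vec_p.
Proof.
rewrite /v4_vec sum_v4 /vec_p /v4 /= !scale0r !addr0 -scalerDr.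
by rewrite mulg1 mul1g expg1 lambda1.
Qed.
Let qE : q = v4_vec vec_q.
Proof.
rewrite /v4_vec sum_v4 /vec_q /v4 /= !scale0r !addr0 scaleNr -scalerBr.
by rewrite mulg1 mul1g expg1 lambda1.
Qed.
Let bpE : L b * p = v4_vec vec_bp.
Proof.
rewrite /v4_vec sum_v4 /vec_bp /v4 /= !scale0r !add0r -scalerDr.
by rewrite mulg1 !expg1 /proj_plus -scalerAr mulrDr mulr1 -lambdaM.
Qed.
Let bqE : L b * q = v4_vec vec_bq.
Proof.
rewrite /v4_vec sum_v4 /vec_bq /v4 /= !scale0r !add0r scaleNr -scalerBr.
by rewrite mulg1 !expg1 /proj_minus -scalerAr mulrBr mulr1 -lambdaM.
Qed.

(** In the alternating bicharacter, a character of the Klein group that is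
    nontrivial on [c] (a factor [q]) in one variable is paired with [b] in the
    other. *)
Lemma rmatE : rmat = tensor p p + tensor (L b * p) q + tensor q (L b * p)
                     + tensor (L b * q) (L b * q).
Proof.
rewrite bpE bqE pE qE !tensor_v4_vec !v4_eltD /rmat v4_eltZ; apply: eq_v4_elt.
case=> [[] []] [[] []]; rewrite /v4_sign /vec_p /vec_q /vec_bp /vec_bq /=.
all: by field.
Qed.

Lemma comult_s_vec f :
  Ds (v4_vec f) = v4_elt c b (fun s t => if s == t then f s else 0).
Proof.
rewrite linear_sum; apply: eq_bigr => s _; rewrite linearZ /= comult_s_lambda.
rewrite (bigD1 s) //= eqxx big1 ?addr0 // => t ts.
by rewrite eq_sym (negPf ts) scale0r.
Qed.

Lemma comult_s_proj_plus : Ds p = tensor p p + tensor q q.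
Proof.
rewrite {1}pE comult_s_vec pE qE !tensor_v4_vec v4_eltD; apply: eq_v4_elt.
case=> [[] []] [[] []]; rewrite /vec_p /vec_q /=.
all: by field.
Qed.

Lemma comult_s_proj_minus : Ds q = tensor p q + tensor q p.
Proof.
rewrite {1}qE comult_s_vec pE qE !tensor_v4_vec v4_eltD; apply: eq_v4_elt.
case=> [[] []] [[] []]; rewrite /vec_p /vec_q /=.
all: by field.
Qed.

(** Expanding both products, the terms in which [P] meets [Q] vanish, and the
    four that remain agree pairwise. *)
Lemma tensor_flip_identity (A A' B P Q X : galg C G) :
    (forall u, P * (u * P) = u * P) -> (forall u, P * (u * Q) = 0) ->
    (forall u, Q * (u * P) = 0) -> (forall u, Q * (u * Q) = u * Q) ->
    X * P = A' * P -> X * Q = A * Q ->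
    X * (B * P) = B * (A * P) -> X * (B * Q) = B * (A' * Q) ->
  (tensor P P + tensor (B * P) Q + tensor Q (B * P) + tensor (B * Q) (B * Q))
    * (tensor A A * (tensor P Q + tensor Q P)
       + tensor A' A' * (tensor P P + tensor Q Q))
  = tensor X X
    * (tensor P P + tensor (B * P) Q + tensor Q (B * P)
       + tensor (B * Q) (B * Q)).
Proof.
move=> PP PQ QP QQ XP XQ XBP XBQ.
have t0l u : tensor 0 u = 0 by apply/ffunP=> -[? ?]; rewrite !ffunE mul0r.
have t0r u : tensor u 0 = 0 by apply/ffunP=> -[? ?]; rewrite !ffunE mulr0.
rewrite !mulrDr -!tensorM !mulrDl -!tensorM -!(mulrA B) !(PP, PQ, QP, QQ).
rewrite !(mulr0, t0l, t0r, add0r, addr0) XP XQ XBP XBQ.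
by rewrite (AC (2 * 2) (3 * 1 * 2 * 4)).
Qed.

Local Notation x := (L a * q + L a^-1%g * p).
Local Notation xV := (L a^-1%g * q + L a * p).

Let ba : (b * a = a^-1 * b)%g. Proof. by case: Gab. Qed.
Let baV : (b * a^-1 = a * b)%g.
Proof. by apply: (mulgI a^-1)%g;
  rewrite mulgA -ba -mulgA mulgV mulg1 mulKg. Qed.

Lemma Theta'_a : Th' (L a) = x.
Proof.
have [_ -> _] := Theta'P C Gab.
have aE : L a = L a * p + L a * q by rewrite -mulrDr projD mulr1.
by rewrite scalerAr -/proj_plus mulrBl {1}aE opprB addrC addrA subrK addrC.
Qed.

Let x_plus : x * p = L a^-1%g * p.
Proof. by rewrite mulrDl -!mulrA proj_minus_plus proj_plusK mulr0 add0r. Qed.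
Let x_minus : x * q = L a * q.
Proof. by rewrite mulrDl -!mulrA proj_plus_minus proj_minusK mulr0 addr0. Qed.

Let x_mul u v : x * (u * q + v * p) = L a * u * q + L a^-1%g * v * p.
Proof.
rewrite mulrDr !(mulrA x) -![(_ + _) * _ * _]mulrA -(proj_minusZ u)
  -(proj_plusZ v).
by rewrite !mulrA x_plus x_minus -!mulrA !(proj_minusZ u) (proj_plusZ v).
Qed.

Let xX k : x ^+ k = L (a ^+ k)%g * q + L (a^-1 ^+ k)%g * p.
Proof.
elim: k => [|k IHk]; first by rewrite !expg0 expr0 lambda1 !mul1r addrC projD.
by rewrite exprS IHk x_mul -!lambdaM -!expgS.
Qed.

Let x_xV : x * xV = 1.
Proof. by rewrite x_mul -!lambdaM mulgV mulVg lambda1 !mul1r addrC projD. Qed.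

Let Th'A : ahom_in fullv Th'. Proof. by case: (Theta'P C Gab). Qed.
Let Th'M u v : Th' (u * v) = Th' u * Th' v.
Proof. by have /ahom_inP[-> //] := Th'A; rewrite memvf. Qed.
Let Th'1 : Th' 1 = 1. Proof. by have /ahom_inP[] := Th'A. Qed.

Lemma Theta'_b : Th' (L b) = L (c * b)%g.
Proof. by case: (Theta'P C Gab). Qed.

Lemma Theta'_c : Th' (L c) = L c.
Proof.
rewrite {1}lambdaX ahomX // Theta'_a xX expgVn cV -mulrDr [q + p]addrC projD.
by rewrite mulr1.
Qed.

Let Th'p : Th' p = p.
Proof. by rewrite linearZ linearD /= Th'1 Theta'_c. Qed.
Let Th'q : Th' q = q.
Proof. by rewrite linearZ linearB /= Th'1 Theta'_c. Qed.

Let Theta'_aV : Th' (L a^-1%g) = xV.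
Proof.
rewrite -[LHS]mulr1 -x_xV mulrA -Theta'_a -Th'M -lambdaM mulVg lambda1 Th'1.
by rewrite mul1r.
Qed.

Lemma Theta'K : (Th' \o Th')%VF = \1%VF.
Proof.
apply: (ahom_gen_inj dihedral_generated); first exact: comp_is_ahom.
  exact: id_is_ahom.
move=> g /mem_generators[] ->; rewrite [LHS]comp_lfunE [RHS]id_lfunE;
  last first.
  by rewrite Theta'_b lambdaM Th'M Theta'_b Theta'_c -lambdaM mulgA cc mul1g.
rewrite Theta'_a linearD /= !Th'M Th'p Th'q Theta'_a Theta'_aV x_minus.
by rewrite mulrDl -!mulrA proj_minus_plus proj_plusK mulr0 add0r -mulrDr [q +
  p]addrC projD mulr1.
Qed.

Lemma Theta_Theta'C k : coprime k (2 * n) -> (Th k \o Th')%VF = (Th' \o Th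
  k)%VF.
Proof.
move=> ck; have [ThA Tha Thb] := ThetaP C Gab k; have Thc := Theta_lambda_c ck.
have ThaV := ahom_lambdaV ThA Tha.
move: (Th k) ThA Tha Thb Thc ThaV => phi phiA phia phib phic phiaV.
have /ahom_inP[phiM phi1] := phiA.
have [t'a t'b] := (Theta'_a, Theta'_b).
move: Th' Th'A t'a t'b => psi psiA psia psib.
apply: (ahom_gen_inj dihedral_generated);
  [exact: comp_is_ahom|exact: comp_is_ahom|].
move=> g /mem_generators[] ->; rewrite [LHS]comp_lfunE [RHS]comp_lfunE;
  last first.
  by rewrite psib phib psib lambdaM phiM ?memvf // phib phic.
rewrite psia phia lambdaX ahomX // psia xX linearD /= !phiM ?memvf // phia
  phiaV.
by rewrite !linearZ !linearD linearN /= phi1 phic expgVn.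
Qed.

Let starD u v : star (u + v) = star u + star v.
Proof. by apply/ffunP=> g; rewrite !ffunE rmorphD. Qed.
Let starB u v : star (u - v) = star u - star v.
Proof. by apply/ffunP=> g; rewrite !ffunE rmorphB. Qed.

Let star_p : star p = p.
Proof. by rewrite starZ starD -lambda1 !star_lambda invg1 cV fmorphV
  rmorph_nat. Qed.
Let star_q : star q = q.
Proof. by rewrite starZ starB -lambda1 !star_lambda invg1 cV fmorphV
  rmorph_nat. Qed.

(** Theta' sends the twist to its adjoint, and the square of the twist is
    [rmat]; hence this identity is the compatibility of Theta' with the
    coproduct at [a]. *)
Lemma rmat_Theta'_a : rmat * Ds x = tensor x x * rmat.
Proof.
have /ahom_inP[DsM _] := comult_s_ahom C G.
rewrite linearD /= !DsM ?memvf // comult_s_proj_plus comult_s_proj_minus.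
rewrite !comult_s_lambda -!tensor_lambda rmatE.
apply: (tensor_flip_identity ppu pqu qpu qqu x_plus x_minus).
  by rewrite -(proj_plusZ (L b)) mulrA x_plus -mulrA proj_plusZ !mulrA
    -!lambdaM ba.
by rewrite -(proj_minusZ (L b)) mulrA x_minus -mulrA proj_minusZ !mulrA
  -!lambdaM baV.
Qed.

Lemma Theta'_kac_aut : kac_aut K Th'.
Proof.
have Th'K : cancel Th' Th'.
  by move=> u; rewrite -[LHS]comp_lfunE Theta'K id_lfunE.
pose si (s : bool * bool) := (s.1, s.1 (+) s.2).
have siK : involutive si by case=> [[] []].
have Th'h s : Th' (L (h s)) = L (h (si s)).
  rewrite /v4 lambdaM Th'M (lambdaX _ b) (lambdaX _ c) !ahomX // Theta'_b
    Theta'_c.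
  rewrite -!lambdaX -lambdaM; congr L; case: s => [[] []];
    rewrite /= ?expg1 ?mulg1 ?mul1g //.
    by rewrite -cZ mulgA cc mul1g.
have /ahom_inP[TM _] := tensor_map_ahom Th'A.
have Ttw : tensor_map Th' twist = star twist.
  rewrite star_twist // linearZ /= (tensor_map_v4_elt _ siK) //; congr (_ *: _).
  by apply: eq_v4_elt => s t; rewrite twist_coef_swap.
have Ttws : tensor_map Th' (star twist) = twist.
  rewrite star_twist // linearZ /= (tensor_map_v4_elt _ siK) //; congr (_ *: _).
  by apply: eq_v4_elt => s t; rewrite twist_coef_swap.
apply: (kac_aut_generators Th'A (can_inj Th'K)) => g /mem_generators[] ->.
- rewrite star_lambda Theta'_a Theta'_aV starD !starM !star_lambda invgK star_p
  star_q.
  by rewrite proj_minusZ proj_plusZ.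
- rewrite star_lambda (ahom_lambdaV Th'A Theta'_b) Theta'_b star_lambda //.
- rewrite !comult_KDE !TM ?memvf // Ttw Ttws comult_s_lambda -tensor_lambda
  tensor_mapE.
  rewrite Theta'_a.
  have := rmat_Theta'_a; rewrite -(twist_sqr C cc bb (cZ b)).
  move=> /(congr1 (fun w => star twist * w * star twist)).
  rewrite !mulrA star_twist_unitary // mul1r => ->.
  by rewrite -!mulrA twist_unitary // mulr1.
have Lb : L b = L (h (true, false)) by apply: lambda_b.
have uG s : comult K (L (h s)) = tensor (L (h s)) (L (h s)).
  by rewrite comult_KDE; apply: group_like_v4 => //; apply: cZ.
by rewrite Lb Th'h !uG tensor_mapE Th'h.
Qed.

End Converse.
(** * The automorphism group *)

Section AutomorphismGroup.
Variables (C : numClosedFieldType) (G : finGroupType) (n : nat) (a b : G).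
Hypotheses (n_ge3 : (3 <= n)%N) (Gab : dihedral_gens n a b).

Local Notation c := (a ^+ n)%g.
Local Notation K := (KD C n a b).
Local Notation L := (lambda C).
Local Notation Th := (Theta C n a b).
Local Notation Th' := (Theta' C n a b).

Lemma kac_autM_in phi psi :
  kac_aut K phi -> kac_aut K psi -> kac_aut K (phi \o psi)%VF.
Proof. by move=> phiP psiP; apply/set_mem/kac_autM; apply/mem_set. Qed.

(** An automorphism that exchanges [b] and [bc] is composed with Theta' to
    fix the Klein group. *)
Lemma kac_aut_KD : kac_aut K = A2n C n a b.
Proof.
apply/seteqP; split=> phi /= => [phiP|[k [ck phiE]]]; last first.
  have kP := Theta_kac_aut C Gab ck.
  case: phiE => ->; [exact: kP|exact: (kac_autM_in kP (Theta'_kac_aut C Gab))].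
have [[] phib] := kac_aut_b n_ge3 Gab phiP; last first.
  rewrite mulg1 in phib.
  by have [k ck ->] := kac_aut_fix_v4 n_ge3 Gab phiP phib; exists k;
    split=> //; left.
have psiP := kac_autM_in phiP (Theta'_kac_aut C Gab).
have [|k ck phiE] := kac_aut_fix_v4 n_ge3 Gab psiP.
  have [/ahom_inP[phiM _] _ _ _] := phiP.
  rewrite [LHS]comp_lfunE Theta'_b // lambdaM phiM ?memvf // (kac_aut_c n_ge3
    Gab phiP).
  by rewrite phib expg1 -lambdaM -(dihedral_cZ Gab b) mulgA (dihedral_cc Gab)
    mul1g.
exists k; split=> //; right.
by rewrite -phiE -comp_lfunA Theta'K // comp_lfun1r.
Qed.

Local Notation N := (2 * n)%N.

Let N_gt1 : (1 < N)%N.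
Proof. by rewrite (leq_trans _ (leq_mul (leqnn 2) n_ge3)). Qed.

Definition Theta'_pow (e : 'Z_2) : 'End(galg C G) :=
  if e == 0 then \1%VF else Th'.

Definition A2n_elt (z : 'Z_2 * {unit 'Z_N}) : 'End(galg C G) :=
  (Th (val (val z.2)) \o Theta'_pow z.1)%VF.

Lemma unit_coprime (u : {unit 'Z_N}) : coprime (val (val u)) N.
Proof. by rewrite coprime_sym -unitZpE // natr_Zp (valP u). Qed.

Lemma Z2_cases (e : 'Z_2) : e = 0 \/ e = 1.
Proof.
by case: e => [[|[|//]]] i; [left|right]; apply/val_inj.
Qed.

Lemma Theta'_powD (e e' : 'Z_2) :
  Theta'_pow (e + e') = (Theta'_pow e \o Theta'_pow e')%VF.
Proof.
have [->|->] := Z2_cases e; have [->|->] := Z2_cases e';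
  rewrite /Theta'_pow ?add0r ?addr0 ?eqxx ?comp_lfun1l ?comp_lfun1r //.
by rewrite Theta'K.
Qed.

Lemma Theta_Theta'_powC (u : {unit 'Z_N}) e :
  (Theta'_pow e \o Th (val (val u)) = Th (val (val u)) \o Theta'_pow e)%VF.
Proof.
rewrite /Theta'_pow; case: eqP => _; first by rewrite comp_lfun1l comp_lfun1r.
exact/esym/(Theta_Theta'C C Gab (unit_coprime u)).
Qed.

Lemma A2n_eltM z z' :
  A2n_elt (z.1 + z'.1, (z.2 * z'.2)%g) = (A2n_elt z \o A2n_elt z')%VF.
Proof.
rewrite /A2n_elt /= Theta'_powD.
have -> : Th (val (val (z.2 * z'.2)%g))
          = (Th (val (val z.2)) \o Th (val (val z'.2)))%VF.
  have mod_trunc m : (m %% (Zp_trunc N).+2 = m %[mod N])%N.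
    by rewrite Zp_cast // modn_mod.
  by rewrite (Theta_comp C Gab); apply/(Theta_mod C Gab)/mod_trunc.
rewrite -!comp_lfunA; congr (_ \o _)%VF.
by rewrite !comp_lfunA Theta_Theta'_powC.
Qed.

Lemma A2n_elt_b z : A2n_elt z (L b) = L (c ^+ val z.1 * b)%g.
Proof.
case: z => e u; have [TA _ Tb] := ThetaP C Gab (val (val u)).
have Tc := Theta_lambda_c C Gab (unit_coprime u).
have T'b := Theta'_b C Gab.
rewrite /A2n_elt /Theta'_pow;
  move: (Th _) Th' TA Tb Tc T'b => phi psi TA Tb Tc T'b.
rewrite comp_lfunE /=; have [->|->] := Z2_cases e; rewrite /=.
  by rewrite id_lfunE mul1g.
rewrite T'b lambdaM; have /ahom_inP[TM _] := TA.
by rewrite TM ?memvf // Tb Tc -lambdaM.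
Qed.

Let expg_lt_inj i j : (i < N)%N -> (j < N)%N -> (a ^+ i = a ^+ j)%g -> i = j.
Proof.
move=> iN jN /eqP; rewrite eq_expg_mod_order (dihedral_order Gab).
by rewrite !modn_small // => /eqP.
Qed.

Lemma A2n_elt_inj : injective A2n_elt.
Proof.
move=> [e u] [e' u'] E.
have ee' : e = e'.
  have := A2n_elt_b (e, u); rewrite E A2n_elt_b => /lambda_inj/mulIg/eqP /=.
  have c1 := dihedral_c1 Gab.
  have [->|->] := Z2_cases e; have [->|->] := Z2_cases e' => //=.
    by rewrite ?expg1 (negPf c1).
  by rewrite eq_sym ?expg1 (negPf c1).
rewrite -{e'}ee' in E *; congr (e, _).
have TE : Th (val (val u)) = Th (val (val u')).
  have eK : (Theta'_pow e \o Theta'_pow e)%VF = \1%VF.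
    rewrite -Theta'_powD /Theta'_pow.
    by have -> : e + e = 0 by have [->|->] := Z2_cases e; apply/val_inj.
  have P_inj (phi psi : 'End(galg C G)) :
      (phi \o Theta'_pow e = psi \o Theta'_pow e)%VF -> phi = psi.
    move/(congr1 (fun chi : 'End(galg C G) => (chi \o Theta'_pow e)%VF)).
    by rewrite -!comp_lfunA eK !comp_lfun1r.
  exact: P_inj E.
have [_ ua _] := ThetaP C Gab (val (val u)).
have [_ u'a _] := ThetaP C Gab (val (val u')).
move: ua; rewrite TE u'a => /lambda_inj.
have lt_N (w : {unit 'Z_N}) : (val (val w) < N)%N.
  by rewrite -[N in (_ < N)%N](Zp_cast N_gt1) ltn_ord.
move/(expg_lt_inj (lt_N u') (lt_N u)) => uu'.
by apply/val_inj/val_inj; rewrite uu'.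
Qed.

Lemma A2n_elt_range : range A2n_elt = kac_aut K.
Proof.
rewrite kac_aut_KD; apply/seteqP; split=> phi /=.
  case=> -[e u] _ <-; exists (val (val u)); split; first exact: unit_coprime.
  rewrite /A2n_elt /Theta'_pow /=; case: eqP => _; [left|by right].
  by rewrite comp_lfun1r.
case=> k [ck phiE].
have ku : (k%:R : 'Z_N) \is a GRing.unit by rewrite unitZpE // coprime_sym.
have kE : Th (val (k%:R : 'Z_N)) = Th k.
  by apply: (Theta_mod C Gab); rewrite /= (val_Zp_nat N_gt1) modn_mod.
pose u : {unit 'Z_N} := FinRing.unit 'Z_N ku.
case: phiE => ->.
  by exists (0, u); last exact: etrans (comp_lfun1r _) kE.
by exists (1, u); last exact: (congr1 (fun psi => psi \o Th')%VF kE).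
Qed.

Lemma card_kac_aut : (kac_aut K #= `I_(2 * totient N))%card.
Proof.
have cT : #|{: 'Z_2 * {unit 'Z_N}}| = (2 * totient N)%N.
  rewrite card_prod card_ord; congr (2 * _)%N.
  by rewrite -card_units_Zp ?cardsT // (ltn_trans _ N_gt1).
rewrite -A2n_elt_range -cT.
apply: card_eq_trans (_ : range A2n_elt #= [set: 'Z_2 * {unit
  'Z_N}]%classic)%card _.
  by apply: inj_card_eq => z z' _ _; apply: A2n_elt_inj.
have -> : [set: 'Z_2 * {unit 'Z_N}]%classic = range (@enum_val _ {: 'Z_2 *
  {unit 'Z_N}}).
  apply/seteqP; split=> // z _ /=; exists (enum_rank z) => //;
    exact: enum_rankK.
apply: card_eq_trans (_ : _ #= [set: 'I_#|{: 'Z_2 * {unit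
  'Z_N}}|]%classic)%card _.
  by apply: inj_card_eq => z z' _ _; apply: enum_val_inj.
by rewrite card_eq_sym; apply: card_II.
Qed.

(** Theta' commutes with every Theta_k, so the semidirect product is taken with
    respect to the trivial action. *)
Section TrivialAction.
Variables (aT rT : finGroupType) (D : {group aT}) (R : {group rT}).

Definition trivial_act (x : rT) (_ : aT) := x.

Lemma trivial_act_is_action : is_action D trivial_act.
Proof. by split=> // x y z. Qed.

Definition trivial_action := Action trivial_act_is_action.

Lemma trivial_is_groupAction : is_groupAction R trivial_action.
Proof.
move=> x _; rewrite (_ : actperm _ x = 1%g) ?group1 //.
by apply/permP=> y; rewrite actpermE perm1.
Qed.

Definition trivial_groupAction : groupAction D R :=
  GroupAction trivial_is_groupAction.

End TrivialAction.

Local Notation to :=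
  (trivial_groupAction [group of Zp 2] [group of units_Zp N]).

Lemma A2n_eltP z : A2n_elt z \in kac_aut K.
Proof. by apply/mem_set; rewrite -A2n_elt_range; exists z. Qed.

Definition A2n_aut (w : sdprod_by to) : kac_autT K :=
  exist (fun phi => phi \in kac_aut K) _ (A2n_eltP (pair_of_sd w)).

Lemma A2n_autM : {morph A2n_aut : u v / (u * v)%g}.
Proof. by move=> u v; apply: val_inj; rewrite /= -A2n_eltM. Qed.

Lemma A2n_aut_inj : injective A2n_aut.
Proof. by move=> u v /(congr1 val)/A2n_elt_inj/val_inj. Qed.

Lemma A2n_aut_surj phi : exists w, A2n_aut w = phi.
Proof.
have [z _ zE] : range A2n_elt (val phi).
  by rewrite A2n_elt_range; apply/set_mem/(valP phi).
have zin : z \in finset.setX (Zp 2) (units_Zp N) by rewrite /Zp /units_Zp !inE.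
by exists (SdPair to zin); apply: val_inj.
Qed.

Lemma kac_aut_sdprod : exists f : kac_autT K -> sdprod_by to,
  bijective f /\ {morph f : u v / (u * v)%g}.
Proof.
have [f fK] := choice A2n_aut_surj.
have Kf : cancel A2n_aut f by move=> w; apply: A2n_aut_inj; rewrite fK.
exists f; split; first by exists A2n_aut.
by move=> u v; apply: A2n_aut_inj; rewrite A2n_autM !fK.
Qed.

End AutomorphismGroup.

Theorem theorem5p5p7 (R : realType) (n : nat) (G : finGroupType) (a b : G)
    (n_ge3 : (3 <= n)%N) (Gab : dihedral_gens n a b) :
  [/\ kac_aut (KD R[i]%C n a b) = A2n R[i]%C n a b,
      (kac_aut (KD R[i]%C n a b) #= `I_(2 * totient (2 * n)))%card
    & exists (to : groupAction (Zp 2) (units_Zp (2 * n)))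
             (f : kac_autT (KD R[i]%C n a b) -> sdprod_by to),
        bijective f /\ {morph f : u v / (u * v)%g}].
Proof.
split; [exact: kac_aut_KD|exact: card_kac_aut|].
exact: (ex_intro _ _ (kac_aut_sdprod R[i]%C n_ge3 Gab)).
Qed.
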